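(* Unweighted Borda Manipulation can be solved in time $O^*(t^{2|\mathcal{C}|})$, where $t$ is the number of manipulators and $\mathcal{C}\cup\{p\}$ is the set of candidates.
   Context: Borda elections: a set of candidates $\mathcal{C}\cup\{p\}$ (with $p\notin\mathcal{C}$) and a multiset of votes, each vote being a bijection $\pi:\mathcal{C}\cup\{p\}\to\{1,\dots,|\mathcal{C}|+1\}$. A vote $\pi$ gives candidate $c$ the score $\pi(c)-1$; the total score of a candidate is the sum over all votes. $p$ wins only if it has strictly higher total score than every other candidate. Unweighted Borda Manipulation (UBM): input is an election with candidates $\mathcal{C}\cup\{p\}$ and a multiset $\Pi_{\mathcal{V}}$ of votes in which $p$ is not the winner, and a set $\mathcal{V}'$ of $t$ manipulators. Question: can the manipulators cast votes $\Pi_{\mathcal{V}'}$ so that with all votes $\Pi_{\mathcal{V}}\uplus\Pi_{\mathcal{V}'}$ the candidate $p$ has strictly higher total score than every candidate in $\mathcal{C}$? The notation $O^*(\cdot)$ suppresses factors polynomial in the input size. *)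

(* Defs.v *)
From mathcomp Require Import all_boot fingroup perm.
Set Implicit Arguments. Unset Strict Implicit. Unset Printing Implicit Defensive.

(* Candidates C ∪ {p} are 'I_m.+1, with p := ord0 and C := the other m  *)
(* candidates, so |C| = m.  A vote is a bijection                       *)
(* pi : 'I_m.+1 -> 'I_m.+1 (positions 0..m); candidate c gets           *)
(* val (pi c) points from it, i.e. (1-indexed position) - 1.           *)

Definition vote (m : nat) := {perm 'I_m.+1}.

Definition bscore (m : nat) (vs : seq (vote m)) (c : 'I_m.+1) : nat :=
  \sum_(v <- vs) val (v c).

Definition pcand (m : nat) : 'I_m.+1 := ord0.

Definition p_wins (m : nat) (vs : seq (vote m)) : Prop :=
  forall c : 'I_m.+1, c != pcand m -> bscore vs c < bscore vs (pcand m).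

Record ubm_instance := UBMInstance {
  ubm_m : nat;
  ubm_votes : seq (vote ubm_m);
  ubm_t : nat }.

Definition ubm_promise (I : ubm_instance) : Prop := ~ p_wins (ubm_votes I).

Definition ubm_yes (I : ubm_instance) : Prop :=
  exists mv : seq (vote (ubm_m I)),
    size mv = ubm_t I /\ p_wins (ubm_votes I ++ mv).

Definition ubm_encode (I : ubm_instance) : seq nat :=
  [:: ubm_m I; ubm_t I; size (ubm_votes I)] ++
  flatten [seq [seq nat_of_ord (v c) | c <- enum 'I_(ubm_m I).+1]
          | v : vote (ubm_m I) <- ubm_votes I].

(* Input size: length of the encoding plus t (the t manipulators are
   part of the input). *)
Definition ubm_size (I : ubm_instance) : nat := size (ubm_encode I) + ubm_t I.

(* Model of computation: unit-cost RAM with addition, truncated         *)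
(* subtraction, indirect addressing and conditional jumps.              *)
Inductive instr :=
| IConst (r k : nat)
| IAdd (r a b : nat)
| ISub (r a b : nat)
| ILoad (r a : nat)
| IStore (a r : nat)
| IJz (r l : nat)
| IJmp (l : nat)
| IHalt.

Definition program := seq instr.

Record config := Config { pc : nat; mem : nat -> nat }.

Definition upd (M : nat -> nat) (r v : nat) : nat -> nat :=
  fun i => if i == r then v else M i.

(* One step; None means the machine has halted (Halt instruction or
   program counter out of range). *)
Definition step (P : program) (c : config) : option config :=
  let M := mem c in
  let n := (pc c).+1 in
  match nth IHalt P (pc c) with
  | IConst r k => Some (Config n (upd M r k))
  | IAdd r a b => Some (Config n (upd M r (M a + M b)))
  | ISub r a b => Some (Config n (upd M r (M a - M b)))
  | ILoad r a => Some (Config n (upd M r (M (M a))))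
  | IStore a r => Some (Config n (upd M (M a) (M r)))
  | IJz r l => Some (Config (if M r == 0 then l else n) M)
  | IJmp l => Some (Config l M)
  | IHalt => None
  end.

Fixpoint run (P : program) (s : nat) (c : config) : config :=
  match s with
  | 0 => c
  | s'.+1 => match step P c with Some c' => run P s' c' | None => c end
  end.

Definition halted (P : program) (c : config) : Prop := step P c = None.

Definition init_config (inp : seq nat) : config :=
  Config 0 (fun i => if i is j.+1 then nth 0 inp j else size inp).

Definition decides_within (P : program) (inp : seq nat) (s : nat) (ans : Prop)
  : Prop :=
  exists s', s' <= s /\
    let c := run P s' (init_config inp) in
    halted P c /\ (mem c 0 != 0 <-> ans).

(* Main.v *)
Require Import Defs.
From mathcomp Require Import all_boot fingroup perm zify.
Set Implicit Arguments. Unset Strict Implicit. Unset Printing Implicit Defensive.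
(* The manipulators may put p on top of every vote (exchanging p with the top
   candidate only helps).  The other m candidates then share the positions
   0, ..., m-1, and candidate c must collect less than
   capacity c = score p + t * m - score c.  A matrix of multiplicities whose rows
   and columns all sum to t is a sum of t permutation matrices (Hall), so it
   suffices to choose, for each candidate, t positions of sum less than its
   capacity, such that each position is used t times in total.  Serving the
   candidates one after the other, one position at a time, only the number of
   uses of each position matters (a vector in {0, ..., t}^m) together with the
   largest budget that the current candidate can have left: this is a table with
   (t+1)^m <= t^(2m) entries if t >= 2.  For t = 1, where 2^m entries are too
   many, Hall's condition reads: for every k < m, at most k candidates have
   capacity at most k.  Without given votes m need not be bounded by the input
   size, but then the manipulators succeed as soon as t > 0. *)

(** * Doubly regular matrices and permutations *)
(** Hall's marriage theorem, by induction on the size of [D]. If a proper nonempty subset [S] is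
    tight, [S] and [D :\: S] are matched separately, the latter outside the neighbourhood of [S].
    Otherwise every such subset has a neighbour to spare, and any pair [x0], [u0] can be matched
    first. [f0] provides the function when [D] is empty. *)
Lemma hall_on (T U : finType) (f0 : T -> U) (D : {set T}) (e : T -> {set U}) :
  (forall S : {set T}, S \subset D -> #|S| <= #|\bigcup_(x in S) e x|) ->
  exists f : T -> U, {in D &, injective f} /\ {in D, forall x, f x \in e x}.
Proof.
have [n] := ubnP #|D|; elim: n D e => // n IHn D e ltDn hallD.
have [->|[x0 Dx0]] := set_0Vmem D.
  by exists f0; split=> [x y|x]; rewrite inE.
have [/existsP[S /and4P[sSD SD S0 leS]]|/existsPn noS] := boolP [exists S : {set T},
    [&& S \subset D, S != D, S != set0 & #|\bigcup_(x in S) e x| <= #|S|]].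
  have ltSD : #|S| < #|D| by apply: proper_card; rewrite properEneq SD.
  have [|X XS|f [finj fe]] := IHn S e.
  - by apply: leq_trans ltSD _; rewrite -ltnS.
  - by apply: hallD; apply: subset_trans sSD.
  set N := \bigcup_(x in S) e x in leS.
  have [|X XDS|g [ginj ge]] := IHn (D :\: S) (fun x => e x :\: N).
  - rewrite cardsD (setIidPr sSD).
    have : 0 < #|S| by rewrite card_gt0.
    by move: (subset_leq_card sSD) ltDn; lia.
  - have dXS : [disjoint X & S].
      by rewrite -setI_eq0; apply/eqP/setP => x; rewrite !inE;
         apply/negP => /andP[/(subsetP XDS)]; rewrite inE => /andP[/negP].
    (* Hall's condition for [X :|: S], less the tight part [S], is Hall's condition for [X] outside
       [N]. *)
    have := hallD (X :|: S).
    rewrite subUset sSD (subset_trans XDS (subsetDl _ _)) => /(_ isT).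
    rewrite bigcup_setU -/N cardsU (disjoint_setI0 dXS) cards0 subn0.
    have -> : \bigcup_(x in X) e x :|: N = \bigcup_(x in X) (e x :\: N) :|: N.
      apply/setP => u; rewrite !inE; have [|uN] := boolP (u \in N); rewrite ?orbT // !orbF.
      by apply/bigcupP/bigcupP => -[x xX ux]; exists x => //; move: ux; rewrite !inE uN.
    rewrite cardsU; lia.
  exists (fun x => if x \in S then f x else g x).
  have inN x : x \in S -> f x \in N by move=> xS; apply/bigcupP; exists x => //; apply: fe.
  have ninN x : x \in D -> x \notin S -> g x \in e x :\: N.
    by move=> xD xS; apply: ge; rewrite inE xS.
  split=> [x y xD yD|x xD].
    case: ifPn => xS; case: ifPn => yS.
    + exact: finj.
    + by move=> E; have := ninN y yD yS; rewrite -E inE inN.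
    + by move=> E; have := ninN x xD xS; rewrite E inE inN.
    + by apply: ginj; rewrite inE ?xS ?yS.
  case: ifPn => xS; first exact: fe.
  by have := ninN x xD xS; rewrite inE => /andP[].
have [u0 eu0] : exists u, u \in e x0.
  apply/set0Pn; rewrite -card_gt0; have := hallD [set x0].
  by rewrite sub1set Dx0 cards1 big_set1; apply.
have [|X XD|f [finj fe]] := IHn (D :\ x0) (fun x => e x :\ u0).
- by move: ltDn; rewrite (cardsD1 x0 D) Dx0.
- have [->|X0] := eqVneq X set0; first by rewrite cards0.
  have := noS X; rewrite X0 (subset_trans XD (subsetDl _ _)) /= negb_and negbK -ltnNge.
  case/orP => [/eqP XeqD|ltX].
    by have := subsetP XD x0; rewrite XeqD Dx0 !inE eqxx => /(_ isT).
  (* Removing [u0] costs at most one neighbour, which the strict inequality [ltX] affords. *)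
  have : \bigcup_(x in X) e x \subset u0 |: \bigcup_(x in X) (e x :\ u0).
    apply/subsetP => u /bigcupP[x xX ux]; rewrite !inE.
    by case: (eqVneq u u0) => //= uu; apply/bigcupP; exists x => //; rewrite !inE uu.
  move/subset_leq_card; rewrite cardsU1; lia.
exists (fun x => if x == x0 then u0 else f x).
have fD x : x \in D -> x != x0 -> f x \in e x :\ u0.
  by move=> xD xx0; apply: fe; rewrite !inE xx0.
split=> [x y xD yD|x xD].
  case: (eqVneq x x0) => [->|xx0]; case: (eqVneq y x0) => [->|yx0] //.
  + by move=> E; have := fD y yD yx0; rewrite -E !inE eqxx.
  + by move=> E; have := fD x xD xx0; rewrite E !inE eqxx.
  + by apply: finj; rewrite !inE ?xx0 ?yx0.
case: (eqVneq x x0) => [->//|xx0].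
by have := fD x xD xx0; rewrite !inE => /andP[].
Qed.

Lemma hall_perm (T : finType) (e : T -> {set T}) :
  (forall S : {set T}, #|S| <= #|\bigcup_(x in S) e x|) ->
  exists s : {perm T}, forall x, s x \in e x.
Proof.
move=> h; have [//|f [finj fe]] := @hall_on _ _ id [set: T] e.
have finj' : injective f by move=> x y; apply: finj; rewrite inE.
by exists (perm finj') => x; rewrite permE fe ?inE.
Qed.

(** Double counting: the rows in [S] carry weight [#|S| * t.+1], all of it in the columns of the
    neighbourhood [N], whose total weight is [#|N| * t.+1]. So the support of [A] satisfies Hall's
    condition. *)
Lemma regular_matrix_perm (T : finType) (t : nat) (A : T -> T -> nat) :
  (forall c, \sum_j A c j = t.+1) -> (forall j, \sum_c A c j = t.+1) ->
  exists s : {perm T}, forall c, 0 < A c (s c).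
Proof.
move=> rowA colA.
have [S|s hs] := @hall_perm _ (fun c => [set j | 0 < A c j]).
  set N := \bigcup_(_ in _) _.
  have : \sum_(c in S) \sum_j A c j <= \sum_(j in N) \sum_c A c j.
    have -> : \sum_(c in S) \sum_j A c j = \sum_(c in S) \sum_(j in N) A c j.
      apply: eq_bigr => c cS; rewrite [LHS](bigID (mem N)) /= [X in _ + X]big1 ?addn0 // => j jN.
      apply/eqP; rewrite -leqn0 leqNgt; apply: contra jN => Acj.
      by apply/bigcupP; exists c; rewrite ?inE.
    rewrite exchange_big leq_sum // => j _.
    by rewrite [leqRHS](bigID (mem S)) /= leq_addr.
  rewrite (eq_bigr (fun=> t.+1)) // [leqRHS](eq_bigr (fun=> t.+1)) // !sum_nat_const.
  by rewrite leq_pmul2r.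
by exists s => c; have := hs c; rewrite inE.
Qed.

Lemma sum_pred1 (T : finType) (j : T) : \sum_(i : T) (j == i) = 1.
Proof. by rewrite (bigD1 j) //= eqxx big1 // => i /negPf; rewrite eq_sym => ->. Qed.

(** Birkhoff's theorem for integer matrices: subtracting a permutation inside the support lowers
    every row and column sum by one. *)
Lemma regular_matrix_decomposition (T : finType) (t : nat) (A : T -> T -> nat) :
  (forall c, \sum_j A c j = t) -> (forall j, \sum_c A c j = t) ->
  exists vs : seq {perm T}, size vs = t /\ forall c j, A c j = \sum_(v <- vs) (v c == j).
Proof.
elim: t A => [|t IHt] A rowA colA.
  exists [::]; split=> // c j; rewrite big_nil.
  by have /eqP := rowA c; rewrite sum_nat_eq0 => /forallP/(_ j)/eqP.
have [s As] := regular_matrix_perm rowA colA.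
have le1 c j : (s c == j) <= A c j by case: eqP => // <-.
have [||vs [szvs Avs]] := IHt (fun c j => A c j - (s c == j)).
- by move=> c; rewrite sumnB // rowA sum_pred1 subn1.
- move=> j; rewrite sumnB // colA.
  have -> : \sum_c (s c == j) = 1; last by rewrite subn1.
  rewrite -(sum_pred1 (s^-1%g j)); apply: eq_bigr => c _.
  by rewrite eq_sym -{1}(permKV s j) (inj_eq perm_inj).
exists (s :: vs); split=> [|c j]; first by rewrite /= szvs.
by rewrite big_cons -Avs subnKC.
Qed.

(** * Manipulations as permutations and as words *)
Lemma card_ord_below (m k : nat) : k <= m -> #|[set j : 'I_m | j < k]| = k.
Proof.
move=> lekm; rewrite -sum1_card (eq_bigl (fun j : 'I_m => j < k)) => [|j]; last by rewrite inE.
by rewrite (big_ord_narrow lekm) sum1_card card_ord.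
Qed.

(** The sets of admissible positions are initial segments, so Hall's condition reduces to one
    inequality per threshold [k]. *)
Lemma perm_below_iff (m : nat) (cap : nat -> nat) :
  (exists s : {perm 'I_m}, forall c, s c < cap c) <->
  (forall k, k < m -> \sum_(0 <= c < m) (cap c <= k) <= k).
Proof.
split=> [[s hs] k ltkm|h].
  rewrite big_mkord -big_mkcond sum1_card /=.
  have sub : [set s c | c : 'I_m in [pred c : 'I_m | cap c <= k]] \subset [set j : 'I_m | j < k].
    apply/subsetP => _ /imsetP[c capc ->]; rewrite inE.
    by apply: leq_trans (hs c) _; move: capc; rewrite inE.
  move: (subset_leq_card sub); rewrite card_imset; last exact: perm_inj.
  move/leq_trans; apply.
  by rewrite card_ord_below // ltnW.
have [S|s hs] := @hall_perm _ (fun c : 'I_m => [set j : 'I_m | j < cap c]); last first.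
  by exists s => c; have := hs c; rewrite inE.
set N := \bigcup_(_ in _) _.
have [NT|[j0 Nj0]] : N = setT \/ exists j, j \notin N.
- have [/existsP[j jN]|/existsPn NT] := boolP [exists j, j \notin N]; first by right; exists j.
  by left; apply/setP => j; rewrite inE; have := NT j; rewrite negbK.
- by rewrite NT; apply: subset_leq_card; apply: subsetT.
(* The least position [j] outside [N] bounds the capacities in [S], and all positions below it lie
   in [N]; hence [#|S| <= j <= #|N|]. *)
have [j jN jmin] := @arg_minnP _ j0 (fun j => j \notin N) val Nj0.
apply: leq_trans (_ : j <= _).
  apply: leq_trans (h j (ltn_ord j)); rewrite big_mkord -big_mkcond sum1_card.
  apply: subset_leq_card; apply/subsetP => c cS; change (cap c <= j); rewrite leqNgt.
  by apply: contra jN => ltj; apply/bigcupP; exists c; rewrite ?inE.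
rewrite -(card_ord_below (ltnW (ltn_ord j))).
apply: subset_leq_card; apply/subsetP => i; rewrite inE => ltij.
by apply/negPn/negP => /jmin /=; rewrite leqNgt ltij.
Qed.

(** [t * m] is what [p] gains on top of all manipulating votes. As [p] has index 0, candidate [c] of
    the others is [inord c.+1]. Truncation is harmless: [x < a - b] iff [x + b < a]. *)
Definition capacity (m : nat) (V : seq (vote m)) (t : nat) (c : nat) : nat :=
  bscore V (pcand m) + t * m - bscore V (inord c.+1).

(* Exchanging p with the candidate at the top of a vote only hurts the others. *)
Lemma vote_dominated (m : nat) (v : vote m) :
  exists w : {perm 'I_m}, forall c : 'I_m, w c <= v (lift ord0 c).
Proof.
pose v' c : 'I_m.+1 := tperm (v ord0) ord_max (v (lift ord0 c)).
have v'm c : v' c < m.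
  have : v' c != ord_max.
    rewrite /v' -{2}(tpermL (v ord0) ord_max) (inj_eq perm_inj) (inj_eq perm_inj).
    by rewrite eq_sym neq_lift.
  by rewrite -val_eqE /= => ne; rewrite ltn_neqAle ne -ltnS ltn_ord.
pose f c : 'I_m := Ordinal (v'm c).
have finj : injective f.
  by move=> c d /(congr1 val) /= /val_inj /perm_inj /perm_inj /lift_inj.
exists (perm finj) => c; rewrite permE /= /v'.
case: tpermP => [/perm_inj E|->|//]; last by rewrite -ltnS ltn_ord.
by have := neq_lift ord0 c; rewrite E eqxx.
Qed.

Lemma bscore_cat (m : nat) (V W : seq (vote m)) (c : 'I_m.+1) :
  bscore (V ++ W) c = bscore V c + \sum_(v <- W) v c.
Proof. by rewrite /bscore big_cat. Qed.

(** Forwards, each vote is replaced by a permutation that gives the others no more, while [p] had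
    gained at most [t * m]. Backwards, [lift_perm ord0 ord_max] puts [p] on top. *)
Lemma manipulation_perms (m : nat) (V : seq (vote m)) (t : nat) :
  (exists mv : seq (vote m), size mv = t /\ p_wins (V ++ mv)) <->
  (exists vs : seq {perm 'I_m}, size vs = t /\
     forall c : 'I_m, \sum_(v <- vs) v c < capacity V t c).
Proof.
have liftE (c : 'I_m) : inord c.+1 = lift ord0 c.
  by apply: val_inj; rewrite /= inordK // ltnS ltn_ord.
split=> [[mv [szmv win]]|[vs [szvs lt]]].
  have [vs [szvs vsle]] : exists vs : seq {perm 'I_m}, size vs = size mv /\
      forall c : 'I_m, \sum_(v <- vs) v c <= \sum_(v <- mv) v (lift ord0 c).
    elim: mv {szmv win} => [|v mv [vs [szvs IH]]].
      by exists [::]; split=> // c; rewrite !big_nil.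
    have [w lew] := vote_dominated v; exists (w :: vs); split=> [|c].
      by rewrite /= szvs.
    by rewrite !big_cons leq_add.
  exists vs; split=> [|c]; first by rewrite szvs.
  have := win (lift ord0 c) _; rewrite /pcand eq_sym neq_lift => /(_ isT).
  rewrite /capacity liftE /pcand !bscore_cat.
  have : \sum_(v <- mv) v ord0 <= t * m.
    rewrite -szmv -sum1_size big_distrl leq_sum //= => v _.
    by rewrite mul1n -ltnS ltn_ord.
  by have := vsle c; lia.
exists [seq lift_perm ord0 ord_max v | v <- vs]; split; first by rewrite size_map.
move=> c; have [c'|->] := unliftP ord0 c; last by rewrite eqxx.
move=> -> _; rewrite /pcand !bscore_cat !big_map.
have -> : \sum_(v <- vs) lift_perm ord0 ord_max v ord0 = t * m.
  rewrite -szvs -sum1_size big_distrl; apply: eq_bigr => v _.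
  by rewrite lift_perm_id /= ?mul1n.
have -> : \sum_(v <- vs) lift_perm ord0 ord_max v (lift ord0 c') = \sum_(v <- vs) v c'.
  by apply: eq_bigr => v _; rewrite lift_perm_lift lift_max.
have := lt c'; rewrite /capacity liftE /pcand; lia.
Qed.

(* A word, latest letter first, hands positions to the candidates one by one,
   [t] positions to each candidate in turn.  [budget] is the capacity that the
   current candidate has left; 0 means that some capacity has been exhausted,
   which the truncated subtraction propagates. *)
Definition settle (t : nat) (cap : nat -> nat) (u g : nat) : nat :=
  if t %| u then (if 0 < g then cap (u %/ t) else 0) else g.

Fixpoint budget (t : nat) (cap : nat -> nat) (w : seq nat) : nat :=
  if w is j :: w' then settle t cap (size w) (budget t cap w' - j) else cap 0.

Lemma settle_mono t cap u g h : g <= h -> settle t cap u g <= settle t cap u h.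
Proof.
rewrite /settle; case: ifP => // _ le; case: ifP => // g0.
by rewrite (leq_trans g0 le).
Qed.

(** Words grow at the front, so the block of the latest candidate stands first. *)
Fixpoint block_word (b : nat -> seq nat) (k : nat) : seq nat :=
  if k is k'.+1 then b k' ++ block_word b k' else [::].

Lemma size_block_word t b k : (forall c, c < k -> size (b c) = t) ->
  size (block_word b k) = t * k.
Proof.
elim: k => [|k IH] h; first by rewrite muln0.
by rewrite /= size_cat h // IH ?mulnS // => c ltc; apply: h; apply: ltnW.
Qed.

Lemma block_wordP t w k : size w = t * k ->
  exists b, (forall c, c < k -> size (b c) = t) /\ w = block_word b k.
Proof.
elim: k w => [|k IH] w szw.
  exists (fun=> [::]); split=> //=.
  by apply: size0nil; rewrite szw muln0.
have [|b [szb defw]] := IH (drop t w).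
  by rewrite size_drop szw mulnS addKn.
exists (fun c => if c == k then take t w else b c); split=> [c|].
  rewrite ltnS leq_eqVlt; case: eqP => [_ _|_ /=]; last exact: szb.
  by rewrite size_take szw mulnS; case: ltnP => //; lia.
rewrite /= eqxx -{1}(cat_take_drop t w) defw; congr (_ ++ _).
have ext (n : nat) : n <= k ->
    block_word b n = block_word (fun c => if c == k then take t w else b c) n.
  elim: n => //= n IHn ltnk; rewrite IHn 1?ltnW //.
  by case: eqP ltnk => // ->; rewrite ltnn.
exact: ext.
Qed.

(** Inside a block the length is no multiple of [t], so [settle] changes nothing and the positions
    are merely subtracted. *)
Lemma budget_incomplete_block t cap b w k : size w = t * k -> size b < t ->
  budget t cap (b ++ w) = budget t cap w - sumn b.
Proof.
move=> szw; elim: b => [|j b IH] /= ltb; first by rewrite subn0.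
rewrite IH 1?ltnW // /settle size_cat szw -addSn dvdn_addl ?dvdn_mulr //.
by rewrite gtnNdvd // -subnDA addnC.
Qed.

Lemma budget_block t cap b w k : size w = t * k -> size b = t -> 0 < t ->
  budget t cap (b ++ w) = if 0 < budget t cap w - sumn b then cap k.+1 else 0.
Proof.
move=> szw szb t0; case: b szb => [|j b] /= szb; first by rewrite -szb in t0.
rewrite (budget_incomplete_block _ szw) ?szb // /settle size_cat szw -addSn szb.
by rewrite -mulnS dvdn_mulr // mulKn // -subnDA addnC.
Qed.

(** A block that exhausts its capacity leaves 0, and every later block then ends in 0 again. *)
Lemma budget_block_word t cap b k : 0 < t ->
  (forall c, c < k -> size (b c) = t) ->
  budget t cap (block_word b k) =
    if [forall c : 'I_k, sumn (b c) < cap c] then cap k else 0.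
Proof.
move=> t0; elim: k => [|k IH] szb.
  by rewrite ifT //; apply/forallP => -[].
have szb' c : c < k -> size (b c) = t by move=> ltc; apply: szb; apply: ltnW.
rewrite [block_word b _.+1]/= (@budget_block t cap (b k) (block_word b k) k); [|exact: size_block_word|exact: szb|by []]. rewrite IH //.
congr (if _ then _ else _); rewrite subn_gt0.
case: forallP => [lt|nlt].
  apply/idP/forallP => [ltk c|/(_ ord_max)//].
  have [->//|nck] := eqVneq (val c) k.
  have ltck : c < k by rewrite ltn_neqAle nck -ltnS ltn_ord.
  exact: (lt (Ordinal ltck)).
rewrite ltn0; apply/esym/negP => /forallP lt; apply: nlt => c.
exact: (lt (widen_ord (leqnSn k) c)).
Qed.

Lemma sum_count_mem m (s : seq nat) : all (ltn^~ m) s ->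
  \sum_(j < m) count_mem (val j) s = size s.
Proof.
elim: s => [|x s IH] /=; first by rewrite big1.
case/andP=> ltx /IH {}IH; rewrite big_split /= IH -add1n; congr (_ + _).
rewrite -(sum_pred1 (Ordinal ltx)); apply: eq_bigr => j _.
by rewrite -val_eqE.
Qed.

Lemma sumn_count_mem m (s : seq nat) : all (ltn^~ m) s ->
  \sum_(j < m) j * count_mem (val j) s = sumn s.
Proof.
elim: s => [|x s IH] /=; first by rewrite big1 // => j _; rewrite muln0.
case/andP=> ltx /IH {}IH.
under eq_bigr do rewrite mulnDr.
rewrite big_split /= IH; congr (_ + _).
rewrite (bigD1 (Ordinal ltx)) //= eqxx muln1 big1 ?addn0 // => j.
by rewrite -val_eqE /= eq_sym => /negPf ->; rewrite muln0.
Qed.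

Lemma all_block_word (P : pred nat) b k :
  all P (block_word b k) = [forall c : 'I_k, all P (b c)].
Proof.
elim: k => [|k IH] /=; first by apply/esym/forallP => -[].
rewrite all_cat IH; apply/andP/forallP => [[bk /forallP lt] c|lt].
  have [->//|nck] := eqVneq (val c) k.
  have ltck : c < k by rewrite ltn_neqAle nck -ltnS ltn_ord.
  exact: (lt (Ordinal ltck)).
split; first exact: (lt ord_max).
by apply/forallP => c; apply: (lt (widen_ord (leqnSn k) c)).
Qed.

Lemma count_block_word (P : pred nat) b k :
  count P (block_word b k) = \sum_(c < k) count P (b c).
Proof. by elim: k => [|k IH] /=; rewrite ?big_ord0 // big_ord_recr /= count_cat IH addnC. Qed.

(** Block [c] lists the positions that the permutations give to [c]. Conversely, the multiplicities
    of the positions in the blocks form a matrix with row sums [t] (block lengths) and column sums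
    [t] (uses of a position). [cap m] is a sentinel: it is the budget after the last block, so its
    positivity signals success. *)
Lemma perms_words (m t : nat) (cap : nat -> nat) : 0 < t -> 0 < cap m ->
  (exists vs : seq {perm 'I_m}, size vs = t /\
     forall c : 'I_m, \sum_(v <- vs) v c < cap c) <->
  (exists w, [/\ all (ltn^~ m) w, forall j, j < m -> count_mem j w = t
     & 0 < budget t cap w]).
Proof.
move=> t0 capm; split=> [[vs [szvs lt]]|[w [wm cntw budw]]].
  pose b c := if insub c is Some c' then [seq val ((v : {perm 'I_m}) c') | v <- vs] else [::].
  have bE (c : 'I_m) : b c = [seq val ((v : {perm 'I_m}) c) | v <- vs] by rewrite /b valK.
  exists (block_word b m); split.
  - rewrite all_block_word; apply/forallP => c; rewrite bE all_map.
    by apply/allP => v _ /=; apply: ltn_ord.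
  - move=> j ltj; rewrite count_block_word.
    under eq_bigr do rewrite bE count_map -sum1_count big_mkcond.
    rewrite exchange_big /= -szvs -sum1_size; apply: eq_bigr => v _.
    rewrite (bigD1 ((v^-1)%g (Ordinal ltj))) //= permKV eqxx big1 // => c.
    by rewrite -(inj_eq (@perm_inj _ v)) permKV -val_eqE => /negPf /= ->.
  - rewrite budget_block_word // => [|c ltc].
      rewrite ifT //; apply/forallP => c; rewrite bE sumnE big_map; exact: lt.
    by rewrite (bE (Ordinal ltc)) size_map.
have szw : size w = t * m.
  rewrite -(sum_count_mem wm) (eq_bigr (fun=> t)) => [|j _]; last exact: cntw (ltn_ord j).
  by rewrite sum_nat_const card_ord mulnC.
have [b [szb defw]] := block_wordP szw.
have bm (c : 'I_m) : all (ltn^~ m) (b c).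
  by move: wm; rewrite defw all_block_word => /forallP.
have lt (c : 'I_m) : sumn (b c) < cap c.
  by move: budw; rewrite defw budget_block_word //; case: ifP => // /forallP.
have [||vs [szvs vsE]] := @regular_matrix_decomposition _ t
    (fun c j : 'I_m => count_mem (val j) (b c)).
- by move=> c; rewrite sum_count_mem // szb.
- by move=> j; rewrite -count_block_word -defw cntw ?ltn_ord.
exists vs; split=> // c; apply: leq_trans (lt c); rewrite ltnS.
rewrite -(sumn_count_mem (bm c)).
under [leqRHS]eq_bigr do rewrite vsE big_distrr.
rewrite exchange_big /= leq_sum // => v _.
by rewrite (bigD1 (v c)) //= eqxx muln1 leq_addr.
Qed.

(** * The table of budgets *)
Definition digit (B N j : nat) : nat := N %/ B ^ j %% B.

Lemma modn_digit B N j : 0 < B -> N %% B ^ j.+1 = digit B N j * B ^ j + N %% B ^ j.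
Proof.
move=> B0; have Bj0 : 0 < B ^ j by rewrite expn_gt0 B0.
rewrite /digit [in LHS](divn_eq N (B ^ j)) [in LHS](divn_eq (N %/ B ^ j) B).
rewrite mulnDl -addnA -mulnA -expnS modnMDl modn_small //.
rewrite expnS; have := ltn_pmod (N %/ B ^ j) B0; have := ltn_pmod N Bj0.
set a := _ %% _; set b := _ %% _ => lta ltb.
apply: (@leq_trans (b.+1 * B ^ j)); last by rewrite leq_mul2r ltb orbT.
by rewrite mulSn addnC ltn_add2r.
Qed.

(** At a nonzero digit the subtraction needs no borrowing. *)
Lemma digit_sub B N j i : 0 < B -> 0 < digit B N j ->
  digit B (N - B ^ j) i = digit B N i - (i == j).
Proof.
move=> B0 dj; have leN : B ^ j <= N.
  rewrite -divn_gt0 ?expn_gt0 ?B0 // lt0n; apply: contraL dj => /eqP.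
  by rewrite /digit => ->; rewrite mod0n.
rewrite {1}/digit; case: (ltngtP i j) => [ltij|ltji|->].
(* Below [j], the quotient by [B ^ i] loses a multiple of [B]. *)
- have -> : B ^ j = B ^ (j - i) * B ^ i by rewrite -expnD subnK // ltnW.
  rewrite divnBMl -(subnSK ltij) expnS subn0 /digit.
  have [e He] : exists e, N %/ B ^ i = e + B * B ^ (j - i.+1).
    exists (N %/ B ^ i - B * B ^ (j - i.+1)); rewrite subnK //.
    by rewrite -expnS subnSK // leq_divRL ?expn_gt0 ?B0 // -expnD subnK // ltnW.
  by rewrite He addnK [in RHS]mulnC [in RHS]addnC modnMDl.
(* Above [j], the power [B ^ j] fits into the remainder modulo [B ^ i], so the quotient stays. *)
- rewrite subn0 /digit; congr (_ %% _).
  have Bi0 : 0 < B ^ i by rewrite expn_gt0 B0.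
  have leR : B ^ j <= N %% B ^ i.
    have /dvdnP[q Bq] : B ^ j.+1 %| B ^ i by apply: dvdn_exp2l.
    have -> : B ^ j = 1 * B ^ j by rewrite mul1n.
    rewrite -leq_divRL ?expn_gt0 ?B0 //.
    rewrite lt0n; apply: contraL dj => /eqP E; rewrite -leqNgt leqn0 /digit.
    have := divn_eq N (B ^ i); move: E; move: (N %/ _) (N %% _) => a r E ->.
    rewrite Bq expnS !mulnA divnMDl ?expn_gt0 ?B0 // E addn0.
    by rewrite modnMl.
  rewrite {1}(divn_eq N (B ^ i)) -addnBA // divnMDl //.
  by rewrite [X in _ + X]divn_small ?addn0 // (leq_ltn_trans (leq_subr _ _)) // ltn_pmod.
- have -> : N - B ^ j = N - 1 * B ^ j by rewrite mul1n.
  rewrite divnBMl; move: dj; rewrite /digit; set q := N %/ B ^ j => dj.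
  rewrite [in LHS](divn_eq q B) -addnBA // modnMDl modn_small //.
  by rewrite (leq_ltn_trans (leq_subr _ _)) // ltn_pmod.
Qed.

Lemma digit_all_eq0 B m N : 0 < B -> N < B ^ m ->
  (forall j, j < m -> digit B N j = 0) -> N = 0.
Proof.
move=> B0 ltN z; suff h j : j <= m -> N %% B ^ j = 0 by rewrite -(modn_small ltN) h.
elim: j => [|j IH] lej; first by rewrite expn0 modn1.
by rewrite modn_digit // z // mul0n IH // ltnW.
Qed.

(** For [B = t.+1], the number [(B ^ m).-1] indexes the target vector, in which every position is
    used [t] times. *)
Lemma digit_pred_exp B m j : 0 < B -> j < m -> digit B (B ^ m).-1 j = B.-1.
Proof.
move=> B0 ltj; have Bj0 k : 0 < B ^ k by rewrite expn_gt0 B0.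
rewrite /digit.
have -> : (B ^ m).-1 = ((B ^ (m - j.+1)).-1 * B + B.-1) * B ^ j + (B ^ j).-1.
  have -> : B ^ m = B ^ (m - j.+1) * B * B ^ j by rewrite -expnSr -expnD subnSK // subnK // ltnW.
  move: (Bj0 j) (Bj0 (m - j.+1)).
  case: (B ^ (m - j.+1)) => [//|x]; case: (B ^ j) => [//|y]; case: B B0 {Bj0} => [//|z] _ _ _ /=.
  by lia.
rewrite divnMDl // [X in _ + X]divn_small ?addn0; last by case: (B ^ j) (Bj0 j).
by rewrite modnMDl modn_small //; case: B B0 {Bj0}.
Qed.

(** Recursion on the last letter [j]: without it, the vector has index [N - t.+1 ^ j]. The digit sum
    is the length of the word, from which [settle] recognises a completed block. *)
Definition table_step (m t : nat) (cap T : nat -> nat) (N : nat) : nat :=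
  settle t cap (\sum_(0 <= j < m) digit t.+1 N j)
    (\max_(0 <= j < m | 0 < digit t.+1 N j) (T (N - t.+1 ^ j) - j)).

Definition is_table (m t : nat) (cap T : nat -> nat) : Prop :=
  T 0 = cap 0 /\ forall N, 0 < N -> N < t.+1 ^ m -> T N = table_step m t cap T N.

(* The table stores, for each vector of numbers of uses of the positions
   (read as the digits of [N]), the largest budget of a word realising it. *)
Lemma table_budget (m t : nat) (cap T : nat -> nat) : is_table m t cap T ->
  forall N, N < t.+1 ^ m ->
  (exists w, [/\ all (ltn^~ m) w, forall j, j < m -> count_mem j w = digit t.+1 N j
     & T N = budget t cap w]) /\
  (forall w, all (ltn^~ m) w -> (forall j, j < m -> count_mem j w = digit t.+1 N j) ->
     budget t cap w <= T N).
Proof.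
case=> T0 TS; elim/ltn_ind => N IH ltN.
have B0 : 0 < t.+1 by [].
have dig0 j : digit t.+1 0 j = 0 by rewrite /digit div0n mod0n.
have szw w : all (ltn^~ m) w -> (forall j, j < m -> count_mem j w = digit t.+1 N j) ->
    size w = \sum_(0 <= j < m) digit t.+1 N j.
  move=> wm cw; rewrite -(sum_count_mem wm) big_mkord.
  by apply: eq_bigr => j _; exact: cw (ltn_ord j).
have [N0|N0] := posnP N.
  rewrite N0; split=> [|w wm cw].
    by exists [::]; split=> // j _; rewrite dig0.
  have : size w = 0.
    by rewrite szw ?N0 // big1 // => j _; rewrite dig0.
  by move/size0nil => ->; rewrite T0.
have sub j : j < m -> 0 < digit t.+1 N j ->
    [/\ N - t.+1 ^ j < N & N - t.+1 ^ j < t.+1 ^ m].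
  move=> ltj dj; have ltNN : N - t.+1 ^ j < N by rewrite ltn_subrL N0 expn_gt0.
  by split=> //; apply: ltn_trans ltN.
split=> [|w wm cw].
  (* Some digit is positive, so the maximum is attained by an actual last letter. *)
  have /existsP[j0 dj0] : [exists j : 'I_m, 0 < digit t.+1 N j].
    apply/negbNE/negP => /existsPn h; move: N0; rewrite (@digit_all_eq0 t.+1 m N) // => j ltj.
    by have := h (Ordinal ltj); rewrite -leqNgt leqn0 => /eqP.
  have [] := @eq_bigmax_cond _ [pred j : 'I_m | 0 < digit t.+1 N j] (fun j => T (N - t.+1 ^ j) - j).
    by apply/card_gt0P; exists j0.
  move=> j /= dj maxE; rewrite inE in dj.
  have [ltNN ltNm] := sub j (ltn_ord j) dj.
  have [[w [wm cw TE]] _] := IH _ ltNN ltNm.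
  have cjw k : k < m -> count_mem k (val j :: w) = digit t.+1 N k.
    move=> ltk; rewrite /= cw // digit_sub // eq_sym.
    by case: eqP => [->|]; rewrite ?add0n ?subn0 // subnKC.
  have jwm : all (ltn^~ m) (val j :: w) by rewrite /= ltn_ord wm.
  exists (val j :: w); split=> //; rewrite [LHS]TS // /table_step -(szw _ jwm cjw).
  by rewrite big_mkord maxE TE.
case: w wm cw => [|j w] wm cw.
  by move: N0; rewrite (@digit_all_eq0 t.+1 m N) // => j /cw.
have ltj : j < m by case/andP: wm.
have dj : 0 < digit t.+1 N j by rewrite -cw //= eqxx.
have [ltNN ltNm] := sub j ltj dj.
have [_ /(_ w)] := IH _ ltNN ltNm.
case/andP: (wm) => _ wm' /(_ wm') le.
(* The largest budget is all that must be kept, since subtracting a letter and settling are both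
   monotone. *)
rewrite TS // /table_step -(szw _ wm cw); apply: settle_mono.
rewrite big_mkord; apply: leq_trans (_ : T (N - t.+1 ^ j) - j <= _).
  apply: leq_sub2r; apply: le => k ltk; rewrite digit_sub // -cw //=.
  by rewrite eq_sym; case: eqP => _; rewrite ?subn0 // addKn.
exact: (@leq_bigmax_cond _ _ (fun j : 'I_m => T (N - t.+1 ^ j) - j) (Ordinal ltj)).
Qed.

Lemma table_manipulation (m t : nat) (cap T : nat -> nat) : 0 < t -> 0 < cap m ->
  is_table m t cap T ->
  (0 < T (t.+1 ^ m).-1) <->
  (exists vs : seq {perm 'I_m}, size vs = t /\
     forall c : 'I_m, \sum_(v <- vs) v c < cap c).
Proof.
move=> t0 capm tabT; rewrite (perms_words t0 capm).
have ltN : (t.+1 ^ m).-1 < t.+1 ^ m by rewrite prednK ?expn_gt0.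
have [[w [wm cw TE]] le] := table_budget tabT ltN.
split=> [T0|[w' [wm' cw' bw']]].
  by exists w; split; rewrite -?TE // => j ltj; rewrite cw // digit_pred_exp.
by apply: leq_trans bw' (le _ wm' _) => j ltj; rewrite digit_pred_exp ?cw'.
Qed.

Lemma single_manipulation (m : nat) (cap : nat -> nat) :
  (exists vs : seq {perm 'I_m}, size vs = 1 /\
     forall c : 'I_m, \sum_(v <- vs) v c < cap c) <->
  (forall k, k < m -> \sum_(0 <= c < m) (cap c <= k) <= k).
Proof.
rewrite -perm_below_iff; split=> [[vs [szvs lt]]|[s lt]].
  case: vs szvs lt => [//|v [|//]] _ lt.
  by exists v => c; have := lt c; rewrite big_seq1.
by exists [:: s]; split=> // c; rewrite big_seq1.
Qed.

(** * A structured language and its compilation to the RAM *)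
(* A structured language over registers and arrays: [Get r a i] and [Put a i r]
   access array [a] at the index held in register [i]; [Loop r c] runs [c] as
   many times as the value of [r], which counts down to 0. *)
Inductive cmd :=
| Skip
| Const (r k : nat)
| Add (r a b : nat)
| Sub (r a b : nat)
| Get (r a i : nat)
| Put (a i r : nat)
| Seq (c d : cmd)
| If (r : nat) (c d : cmd)
| Loop (r : nat) (c : cmd).

Record state := State { reg : nat -> nat; arr : nat -> nat -> nat }.

Definition set_reg (s : state) (r v : nat) : state := State (upd (reg s) r v) (arr s).

Definition set_arr (s : state) (a i v : nat) : state :=
  State (reg s) (fun b => if b == a then upd (arr s b) i v else arr s b).

(** The counter is lowered after the body, which therefore still sees [k.+1]. *)
Fixpoint loop_sem (f : state -> state) (r n : nat) (s : state) : state :=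
  if n is k.+1 then loop_sem f r k (set_reg (f s) r k) else s.

Fixpoint sem (c : cmd) (s : state) : state :=
  match c with
  | Skip => s
  | Const r k => set_reg s r k
  | Add r a b => set_reg s r (reg s a + reg s b)
  | Sub r a b => set_reg s r (reg s a - reg s b)
  | Get r a i => set_reg s r (arr s a (reg s i))
  | Put a i r => set_arr s a (reg s i) (reg s r)
  | Seq c d => sem d (sem c s)
  | If r c d => if reg s r == 0 then sem d s else sem c s
  | Loop r c => loop_sem (sem c) r (reg s r) s
  end.

(** A pass adds four instructions: test, constant 1, decrement, jump back. Leaving the loop costs
    one test. *)
Fixpoint loop_cost (f : state -> state) (g : state -> nat) (r n : nat) (s : state) : nat :=
  if n is k.+1 then (g s + loop_cost f g r k (set_reg (f s) r k)).+4 else 1.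

(** An array access takes six instructions for the address and one for the transfer. The nonzero
    branch of [If] also pays for the jump over the other branch. *)
Fixpoint cost (c : cmd) (s : state) : nat :=
  match c with
  | Skip => 0
  | Const _ _ | Add _ _ _ | Sub _ _ _ => 1
  | Get _ _ _ | Put _ _ _ => 7
  | Seq c d => cost c s + cost d (sem c s)
  | If r c d => if reg s r == 0 then (cost d s).+1 else (cost c s).+2
  | Loop r c => loop_cost (sem c) (cost c) r (reg s r) s
  end.

Fixpoint writes (r : nat) (c : cmd) : bool :=
  match c with
  | Skip | Put _ _ _ => false
  | Const x _ | Add x _ _ | Sub x _ _ | Get x _ _ => x == r
  | Seq c d | If _ c d => writes r c || writes r d
  | Loop x c => (x == r) || writes r c
  end.

(* Registers 29 and 30 are scratch for the compiled code and register 31 holds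
   the base [b] of the arrays: entry [i] of array [a] lives at [b + 8 * i + a]. *)
Fixpoint wf (c : cmd) : bool :=
  match c with
  | Skip => true
  | Const r _ => r < 29
  | Add r a b | Sub r a b => [&& r < 29, a < 29 & b < 29]
  | Get r a i | Put a i r => [&& r < 29, a < 8 & i < 29]
  | Seq c d => wf c && wf d
  | If r c d => [&& r < 29, wf c & wf d]
  | Loop r c => [&& r < 29, ~~ writes r c & wf c]
  end.

(** Three doublings yield [8 * i], as the machine cannot multiply. *)
Definition address_code (a i : nat) : program :=
  [:: IAdd 30 i i; IAdd 30 30 30; IAdd 30 30 30; IConst 29 a; IAdd 30 30 29; IAdd 30 30 31].

(** Jump targets are absolute, so the code depends on the address [l] of its first instruction. *)
Fixpoint compile (l : nat) (c : cmd) : program :=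
  match c with
  | Skip => [::]
  | Const r k => [:: IConst r k]
  | Add r a b => [:: IAdd r a b]
  | Sub r a b => [:: ISub r a b]
  | Get r a i => address_code a i ++ [:: ILoad r 30]
  | Put a i r => address_code a i ++ [:: IStore 30 r]
  | Seq c d => let cc := compile l c in cc ++ compile (l + size cc) d
  | If r c d =>
      let cc := compile l.+1 c in
      let ld := (l + size cc).+2 in
      let dd := compile ld d in
      IJz r ld :: cc ++ IJmp (ld + size dd) :: dd
  | Loop r c =>
      let cc := compile l.+1 c in
      IJz r (l + size cc).+4 :: cc ++ [:: IConst 29 1; ISub r r 29; IJmp l]
  end.

Definition code_at (P : program) (l : nat) (code : program) : Prop :=
  forall i, i < size code -> nth IHalt P (l + i) = nth IHalt code i.

Lemma code_at_cons P l x code : code_at P l (x :: code) ->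
  nth IHalt P l = x /\ code_at P l.+1 code.
Proof.
move=> h; split=> [|i lti]; first by have := h 0 isT; rewrite addn0.
by have := h i.+1 lti; rewrite addnS.
Qed.

Lemma code_at_cat P l code1 code2 : code_at P l (code1 ++ code2) ->
  code_at P l code1 /\ code_at P (l + size code1) code2.
Proof.
move=> h; split=> i lti.
  by rewrite h ?nth_cat ?lti // size_cat ltn_addr.
rewrite -addnA h ?size_cat ?ltn_add2l // nth_cat.
by rewrite ifF ?addKn // ltnNge leq_addr.
Qed.

Lemma run_add P a b c : run P (a + b) c = run P b (run P a c).
Proof.
elim: a c => //= a IH c; case E: (step P c) => [c'|]; first exact: IH.
by case: b {IH} => //= b; rewrite E.
Qed.

(** [32 <= b] keeps the arrays clear of the registers; the scratch registers 29 and 30 are left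
    free. *)
Definition sim (b : nat) (s : state) (M : nat -> nat) : Prop :=
  [/\ 32 <= b, M 31 = b, forall i, i < 29 -> M i = reg s i
    & forall a i, a < 8 -> M (b + 8 * i + a) = arr s a i].

Lemma sim_set_reg b s M r v : sim b s M -> r < 29 -> sim b (set_reg s r v) (upd M r v).
Proof.
case=> b32 M31 Mr Ma ltr; split=> //.
- by rewrite /upd; case: eqP => // E; rewrite -E in ltr.
- by move=> i lti; rewrite /= /upd; case: eqP => // _; apply: Mr.
- by move=> a i lta; rewrite /upd ifF ?Ma //; apply/eqP; lia.
Qed.

Lemma sim_scratch b s M r v : sim b s M -> r = 29 \/ r = 30 -> sim b s (upd M r v).
Proof.
case=> b32 M31 Mr Ma hr; split=> //.
- by rewrite /upd ifF //; apply/eqP; lia.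
- by move=> i lti; rewrite /upd ifF ?Mr //; apply/eqP; lia.
- by move=> a i lta; rewrite /upd ifF ?Ma //; apply/eqP; lia.
Qed.

Lemma sim_set_arr b s M a i v : sim b s M -> a < 8 ->
  sim b (set_arr s a i v) (upd M (b + 8 * i + a) v).
Proof.
case=> b32 M31 Mr Ma lta; split=> //.
- by rewrite /upd ifF //; apply/eqP; lia.
- by move=> k ltk; rewrite /upd ifF ?Mr //; apply/eqP; lia.
- move=> a' i' lta'; rewrite /= /upd.
  case: (eqVneq a' a) => [->|na]; last by rewrite ifF ?Ma //; apply/eqP; lia.
  have -> : (b + 8 * i' + a == b + 8 * i + a) = (i' == i) by lia.
  by case: eqP => // _; apply: Ma.
Qed.

Lemma run_address P l b s M a i n : code_at P l (address_code a i) ->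
  sim b s M -> i < 29 ->
  exists M', [/\ run P (6 + n) (Config l M) = run P n (Config (l + 6) M'),
    sim b s M' & M' 30 = b + 8 * reg s i + a].
Proof.
move=> codeP simM lti.
do 5![case/code_at_cons: codeP => ? codeP]; case/code_at_cons: codeP => ? _.
pose v := reg s i; have Mi : M i = v by case: simM => _ _ -> .
have M31 : M 31 = b by case: simM.
exists (upd (upd (upd (upd (upd (upd M 30 (v + v)) 30 (v + v + (v + v)))
  30 (v + v + (v + v) + (v + v + (v + v)))) 29 a)
  30 (v + v + (v + v) + (v + v + (v + v)) + a))
  30 (v + v + (v + v) + (v + v + (v + v)) + a + b)); split.
- rewrite -[6 + n]/(n.+4.+2) /= /step /=.
  do 6![match goal with H : nth _ _ _ = _ |- _ => rewrite H /=; clear H end].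
  by rewrite !addnS addn0 !Mi /upd /= M31.
- by do 6![apply: sim_scratch; last by tauto].
- by rewrite /upd /=; lia.
Qed.

Lemma writes_sem r c s : ~~ writes r c -> reg (sem c s) r = reg s r.
Proof.
elim: c s => //= [x k|x a b|x a b|x a i|c IHc d IHd|x c IHc d IHd|x c IHc] s.
1-4: by rewrite /upd eq_sym => /negPf ->.
- by rewrite negb_or => /andP[nc nd]; rewrite IHd // IHc.
- by rewrite negb_or => /andP[nc nd]; case: ifP; rewrite ?IHd ?IHc.
- rewrite negb_or => /andP[xr nc]; move: (reg s x) => n.
  elim: n s => //= n IHn s; rewrite IHn /= /upd eq_sym (negPf xr); exact: IHc.
Qed.

(** [cost] is the exact number of steps, so the runs of the parts can be chained by [run_add]. *)
Lemma compile_correct P b c l s M : wf c -> code_at P l (compile l c) -> sim b s M ->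
  exists M', run P (cost c s) (Config l M) = Config (l + size (compile l c)) M' /\
             sim b (sem c s) M'.
Proof.
elim: c l s M => [|r k|r x y|r x y|r a i|a i r|c IHc d IHd|r c IHc d IHd|r c IHc] l s M.
- by exists M; rewrite addn0.
- move=> /= ltr /code_at_cons[Pl _] simM; exists (upd M r k).
  by rewrite /step /= Pl addn1; split=> //; apply: sim_set_reg.
- move=> /= /and3P[ltr ltx lty] /code_at_cons[Pl _] simM; exists (upd M r (M x + M y)).
  rewrite /step /= Pl addn1; split=> //.
  by case: (simM) => _ _ Mr _; rewrite !Mr //; apply: sim_set_reg.
- move=> /= /and3P[ltr ltx lty] /code_at_cons[Pl _] simM; exists (upd M r (M x - M y)).
  rewrite /step /= Pl addn1; split=> //.
  by case: (simM) => _ _ Mr _; rewrite !Mr //; apply: sim_set_reg.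
- move=> /and3P[ltr lta lti] /code_at_cat[cA /code_at_cons[Pl _]] simM.
  have [M' [runE simM' M'30]] := run_address 1 cA simM lti.
  exists (upd M' r (M' (M' 30))); rewrite [cost _ _]/(6 + 1) runE /= /step /= Pl.
  split; first by rewrite -addnS.
  rewrite M'30; case: (simM') => _ _ _ -> //; exact: sim_set_reg.
- move=> /and3P[ltr lta lti] /code_at_cat[cA /code_at_cons[Pl _]] simM.
  have [M' [runE simM' M'30]] := run_address 1 cA simM lti.
  exists (upd M' (M' 30) (M' r)); rewrite [cost _ _]/(6 + 1) runE /= /step /= Pl.
  split; first by rewrite -addnS.
  by rewrite M'30; case: (simM') => _ _ -> // _; apply: sim_set_arr.
- move=> /= /andP[wc wd] /code_at_cat[cc cd] simM.
  have [M1 [run1 sim1]] := IHc _ _ _ wc cc simM.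
  have [M2 [run2 sim2]] := IHd _ _ _ wd cd sim1.
  by exists M2; rewrite run_add run1 run2 size_cat addnA.
- move=> /= /and3P[ltr wc wd] /code_at_cons[Pl /code_at_cat[cc /code_at_cons[Pj cd]]] simM.
  rewrite addSn in Pj cd.
  have Mr : M r = reg s r by case: simM => _ _ ->.
  case: eqP => s0.
    have [M1 [run1 sim1]] := IHd _ _ _ wd cd simM.
    exists M1; split=> //=; rewrite /step /= Pl Mr s0 /= run1; congr Config.
    by rewrite size_cat /=; lia.
  have [M1 [run1 sim1]] := IHc _ _ _ wc cc simM.
  exists M1; split=> //.
  have -> : (cost c s).+2 = 1 + (cost c s + 1) by lia.
  rewrite run_add /= /step /= Pl Mr (introF eqP s0) run_add run1 /=.
  rewrite /step /= addSn Pj; congr Config.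
  by rewrite size_cat /=; lia.
- move=> /= /and3P[ltr nw wc] /code_at_cons[Pl /code_at_cat[cc]].
  case/code_at_cons=> P1 /code_at_cons[P2 /code_at_cons[P3 _]].
  rewrite !addSn in P1 P2 P3; set L := l + _.
  have LE : L = (l + size (compile l.+1 c)).+4 by rewrite /L size_cat /=; lia.
  (* Each pass returns to address [l] with the counter lowered by one, so the induction is on its
     value. *)
  move En: (reg s r) => n; elim: n s M En => [|n IHn] s M En simM.
    exists M; split=> //=; rewrite /step /= Pl.
    by case: simM => _ _ -> // _; rewrite En /= LE.
  have [M1 [run1 sim1]] := IHc _ _ _ wc cc simM.
  have [M2 [run2 sim2]] : exists M2, run P 3 (Config (l.+1 + size (compile l.+1 c)) M1) =
      Config l M2 /\ sim b (set_reg (sem c s) r n) M2.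
    exists (upd (upd M1 29 1) r n); split; last first.
      by apply: sim_set_reg => //; apply: sim_scratch => //; left.
    rewrite addSn /= /step /= P1 /= P2 /= P3; congr (Config _ (upd _ _ _)).
    rewrite /upd eqxx ifF; last by apply/eqP => E; rewrite E in ltr.
    by case: sim1 => _ _ -> // _; rewrite writes_sem // En subn1.
  have [|M3 [run3 sim3]] := IHn _ M2 _ sim2; first by rewrite /= /upd eqxx.
  exists M3; split=> //.
  rewrite [loop_cost _ _ _ _ _]/=.
  set lc := loop_cost _ _ _ _ _ in run3 *.
  have -> : (cost c s + lc).+4 = 1 + (cost c s + (3 + lc)) by lia.
  rewrite run_add /= /step /= Pl; case: (simM) => _ _ -> // _; rewrite En /=.
  by rewrite run_add run1 run_add run2 run3.
Qed.

(** * Moving the input out of the register area *)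

Definition save_code (k n : nat) : program :=
  flatten [seq [:: IStore 0 i; IAdd 0 0 1] | i <- iota k n].

(* Input word [j] is moved from address [j] to [b + 8 * j] with
   [b = 16 * size - 8].  The words at addresses below 32, which the compiled code
   uses as registers, are moved first, by straight-line code in which only
   registers 0 and 1 are overwritten; a loop moves the others. *)
Definition relocation_code : program :=
  [:: IAdd 0 0 0; IAdd 0 0 0; IAdd 0 0 0; IAdd 0 0 0;
      IStore 0 1; IConst 1 8; IAdd 0 0 1] ++ save_code 2 30 ++
  [:: IConst 2 256; ISub 31 0 2; IConst 2 24; ISub 3 31 2; IConst 2 1; IConst 4 32;
      IJz 3 80; ILoad 5 4; IStore 0 5; IAdd 0 0 1; IAdd 4 4 2; ISub 3 3 2; IJmp 73].

(** [w] is the initial memory. Invariant: the words at addresses [k] to [b + 7] are untouched and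
    those before [k] have arrived. All destinations written here lie above [b + 8], so no unread
    word is lost. *)
Lemma run_save_code P w b k n l M : code_at P l (save_code k n) ->
  2 <= k -> k + n <= 32 -> 40 <= b ->
  M 0 = b + 8 * k -> M 1 = 8 -> (forall i, k <= i < b + 8 -> M i = w i) ->
  (forall j, 0 < j < k -> M (b + 8 * j) = w j) ->
  exists M', [/\ run P (n * 2) (Config l M) = Config (l + n * 2) M',
    M' 0 = b + 8 * (k + n), M' 1 = 8,
    forall i, k + n <= i < b + 8 -> M' i = w i
    & forall j, 0 < j < k + n -> M' (b + 8 * j) = w j].
Proof.
elim: n k l M => [|n IH] k l M.
  by move=> *; exists M; rewrite !addn0.
have -> : save_code k n.+1 = IStore 0 k :: IAdd 0 0 1 :: save_code k.+1 n by [].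
move=> /code_at_cons[H1 /code_at_cons[H2 cP]] k2 kn b40 M0 M1 Mi Mj.
pose M' := upd (upd M (b + 8 * k) (w k)) 0 (b + 8 * k.+1).
have [|||||i Hi|j Hj|M2 [run2 M20 M21 M2i M2j]] := IH k.+1 l.+2 M' cP.
- by lia.
- by lia.
- by [].
- by [].
- by rewrite /M' /upd !ifF //; apply/eqP; lia.
- rewrite /M' /upd !ifF; [|apply/eqP; lia..].
  by apply: Mi; lia.
- rewrite /M' /upd ifF; last by apply/eqP; lia.
  by case: eqP => [E|ne]; [congr w; lia|apply: Mj; lia].
exists M2; rewrite (_ : k + n.+1 = k.+1 + n); [split=> //|lia].
have -> : n.+1 * 2 = 1 + (1 + n * 2) by lia.
rewrite !run_add /= /step /= H1 /= H2.
rewrite -[upd _ _ _]/(upd (upd M (M 0) (M k)) 0 _).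
rewrite M0 (Mi k) ?leqnn /=; last by lia.
have -> : upd (upd M (b + 8 * k) (w k)) 0
    (upd M (b + 8 * k) (w k) 0 + upd M (b + 8 * k) (w k) 1) = M'.
  rewrite /M'; congr (upd _ _ _); rewrite /upd !ifF ?M0 ?M1; [lia|apply/eqP; lia..].
by rewrite run2; congr Config; lia.
Qed.

Lemma run_step P n c c' : step P c = Some c' -> run P n.+1 c = run P n c'.
Proof. by move=> /= ->. Qed.

(** Same invariant, with [src] for [k]. The loop goes on to address [b + 7], past the end of the
    input, a bound that is computed from register 31. *)
Lemma run_copy_loop P w b src M :
  code_at P 73 (drop 73 relocation_code) -> 40 <= b -> 32 <= src <= b + 8 ->
  M 0 = b + 8 * src -> M 1 = 8 -> M 2 = 1 -> M 3 = b + 8 - src -> M 4 = src -> M 31 = b ->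
  (forall i, src <= i < b + 8 -> M i = w i) ->
  (forall j, 0 < j < src -> M (b + 8 * j) = w j) ->
  exists M', [/\ run P ((b + 8 - src) * 7 + 1) (Config 73 M) = Config 80 M', M' 31 = b
    & forall j, 0 < j < b + 8 -> M' (b + 8 * j) = w j].
Proof.
move=> cP b40; move En: (b + 8 - src) => n; elim: n src M En => [|n IH] src M En srcb.
  move=> M0 M1 M2 M3 M4 M31 Mi Mj; exists M; split=> //.
    by rewrite /= /step /= (cP 0 isT) /= M3.
  by move=> j Hj; apply: Mj; lia.
move=> M0 M1 M2 M3 M4 M31 Mi Mj.
pose M' := upd (upd (upd (upd (upd M 5 (w src)) (b + 8 * src) (w src))
             0 (b + 8 * src.+1)) 4 src.+1) 3 n.
have bsrc i : i < 32 -> (i == b + 8 * src) = false by lia.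
have [||||||||i Hi|j Hj|M3' [run3 M331 M3j]] := IH src.+1 M'.
- by lia.
- by lia.
- by [].
- by rewrite /M' /upd /= bsrc.
- by rewrite /M' /upd /= bsrc.
- by rewrite /M' /upd /=; lia.
- by [].
- by rewrite /M' /upd /= bsrc.
- rewrite /M' /upd !ifF; [apply: Mi; lia|apply/eqP; lia..].
- rewrite /M' /upd 3?ifN_eq; [|lia..].
  by case: eqP => [E|ne]; [congr w; lia|rewrite ifN_eq ?Mj //; lia].
exists M3'; split=> //.
rewrite (_ : n.+1 * 7 + 1 = (n * 7 + 1).+4.+3); last by lia.
erewrite run_step; last by rewrite /step (cP 0 isT) /= M3.
erewrite run_step; last by rewrite /step (cP 1 isT).
erewrite run_step; last by rewrite /step (cP 2 isT).
erewrite run_step; last by rewrite /step (cP 3 isT).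
erewrite run_step; last by rewrite /step (cP 4 isT).
erewrite run_step; last by rewrite /step (cP 5 isT).
erewrite run_step; last by rewrite /step (cP 6 isT).
rewrite -run3; congr (run _ _ (Config _ _)); rewrite /= /M' M4.
have eqs i : i < 32 -> (b + 8 * src == i) = false by lia.
have Ms : M src = w src by apply: Mi; lia.
congr (upd (upd (upd (upd (upd _ _ _) _ _) _ _) _ _) _ _);
  rewrite /upd /= ?M0 ?bsrc //= ?eqs //= ?M0 ?M1 ?M2 ?M3 ?M4 ?Ms //; lia.
Qed.

(** The copying loop dominates: seven steps for each of [16 * size inp - 32] words. Three input
    words ensure [b >= 40]. *)
Lemma relocation_correct P inp : 3 <= size inp -> code_at P 0 relocation_code ->
  exists n b M, [/\ n <= 200 + 112 * size inp,
    run P n (init_config inp) = Config (size relocation_code) M, 40 <= b, M 31 = b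
    & forall j, 0 < j <= size inp -> M (b + 8 * j) = nth 0 inp j.-1].
Proof.
move=> L3 cP; pose w i := if i is j.+1 then nth 0 inp j else size inp.
pose b := 16 * size inp - 8.
have [_ cP73] : code_at P 0 (take 73 relocation_code) /\ code_at P 73 (drop 73 relocation_code).
  have := @code_at_cat P 0 (take 73 relocation_code) (drop 73 relocation_code).
  by rewrite cat_take_drop; apply.
have [cP1 cP2] := code_at_cat cP.
have [cPs cPe] := code_at_cat cP2.
pose L := size inp.
(* Four doublings of the length give [b + 8], the destination of word 1; once that word is stored,
   register 1 takes the stride 8. *)
pose M1 := upd (upd (upd (upd (upd (upd (upd w 0 (L + L)) 0 (L + L + (L + L)))
  0 (8 * L)) 0 (b + 8)) (b + 8) (w 1)) 1 8) 0 (b + 16).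
have bE : b = 16 * L - 8 by [].
have run1 n : run P n.+4.+3 (Config 0 w) = run P n (Config 7 M1).
  erewrite run_step; last by rewrite /step (cP 0 isT).
  erewrite run_step; last by rewrite /step (cP 1 isT).
  erewrite run_step; last by rewrite /step (cP 2 isT).
  erewrite run_step; last by rewrite /step (cP 3 isT).
  erewrite run_step; last by rewrite /step (cP 4 isT).
  erewrite run_step; last by rewrite /step (cP 5 isT).
  erewrite run_step; last by rewrite /step (cP 6 isT).
  congr (run _ _ (Config _ _)); rewrite /= /M1.
  congr (upd (upd (upd (upd (upd (upd (upd _ _ _) _ _) _ _) _ _) _ _) _ _) _ _);
    by rewrite /upd /= ?ifN_eq //; lia.
have [|||||||M2 [run2 M20 M21 M2i M2j]] := @run_save_code P w b 2 30 7 M1 cPs.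
- by [].
- by [].
- lia.
- by [].
- by [].
- by move=> i Hi; rewrite /M1 /upd !ifN_eq //; lia.
- move=> j Hj; have -> : j = 1 by lia.
  by rewrite muln1 /M1 /upd eqxx 2?ifN_eq //; lia.
pose M3 := upd (upd (upd (upd (upd (upd M2 2 256) 31 b) 2 24) 3 (b - 24)) 2 1) 4 32.
have run3 n : run P n.+4.+2 (Config 67 M2) = run P n (Config 73 M3).
  erewrite run_step; last by rewrite /step (cPe 0 isT).
  erewrite run_step; last by rewrite /step (cPe 1 isT).
  erewrite run_step; last by rewrite /step (cPe 2 isT).
  erewrite run_step; last by rewrite /step (cPe 3 isT).
  erewrite run_step; last by rewrite /step (cPe 4 isT).
  erewrite run_step; last by rewrite /step (cPe 5 isT).
  congr (run _ _ (Config _ _)); rewrite /= /M3.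
  congr (upd (upd (upd (upd (upd (upd _ _ _) _ _) _ _) _ _) _ _) _ _);
    rewrite /upd /= ?M20; lia.
have [||||||||||M4 [run4 M431 M4j]] := @run_copy_loop P w b 32 M3 cP73.
- lia.
- lia.
- by rewrite /M3 /upd /= M20.
- by [].
- by [].
- by rewrite /M3 /upd /=; lia.
- by [].
- by [].
- by move=> i Hi; rewrite /M3 /upd !ifN_eq ?M2i //; lia.
- by move=> j Hj; rewrite /M3 /upd !ifN_eq ?M2j //; lia.
exists ((30 * 2 + ((b + 8 - 32) * 7 + 1).+4.+2).+4.+3), b, M4; split=> //.
- by lia.
- by rewrite run1 run_add run2 run3 run4.
- lia.
- by move=> j Hj; rewrite M4j /w; [case: j Hj|lia].
Qed.

(** Relocation leaves arbitrary values in the registers and the other arrays, so the command must be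
    correct from every state whose array 0 holds the input. The machine halts by running off the end
    of the code. *)
Lemma decides_compiled (c : cmd) (inp : seq nat) (n : nat) (ans : Prop) :
  wf c -> 3 <= size inp ->
  (forall s, (forall j, 0 < j <= size inp -> arr s 0 j = nth 0 inp j.-1) ->
     cost c s <= n /\ (reg (sem c s) 0 != 0 <-> ans)) ->
  decides_within (relocation_code ++ compile (size relocation_code) c) inp
    (200 + 112 * size inp + n) ans.
Proof.
move=> wfc L3 h; set P := _ ++ _.
have cP : code_at P 0 (relocation_code ++ compile (size relocation_code) c) by [].
have [cP1 cP2] := code_at_cat cP.
have [k [b [M [lek runk b40 M31 Mj]]]] := relocation_correct L3 cP1.
pose s := State M (fun a i => M (b + 8 * i + a)).
have [|lec ansE] := h s; first by move=> j Hj; rewrite /= addn0 Mj.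
have simM : sim b s M by split=> //; lia.
have [M' [run' sim']] := compile_correct wfc cP2 simM.
exists (k + cost c s); split; first by rewrite leq_add.
rewrite run_add runk run'; split.
  by rewrite /halted /step /= nth_default // /P size_cat.
by case: sim' => _ _ M'r _; rewrite /= M'r.
Qed.

(** * The decision program *)
Notation "c ;; d" := (Seq c d) (at level 60, right associativity).

Fixpoint stores (a : nat) (c : cmd) : bool :=
  match c with
  | Put b _ _ => b == a
  | Seq c d | If _ c d => stores a c || stores a d
  | Loop _ c => stores a c
  | _ => false
  end.

Lemma stores_sem a c s : ~~ stores a c -> arr (sem c s) a = arr s a.
Proof.
elim: c s => //= [b i r|c IHc d IHd|r c IHc d IHd|r c IHc] s.
- by rewrite eq_sym => /negPf ->.
- by rewrite negb_or => /andP[nc nd]; rewrite IHd // IHc.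
- by rewrite negb_or => /andP[nc nd]; case: ifP; rewrite ?IHd ?IHc.
- move=> nc; move: (reg s r) => n.
  by elim: n s => //= n IHn s; rewrite IHn /= IHc.
Qed.

(** [I k] is the invariant with [k] passes left. Each step may assume that whatever the body does
    not write is as it was at the start. *)
Lemma loop_rule (I : nat -> state -> Prop) (r : nat) (c : cmd) (b : nat) (s0 : state) :
  I (reg s0 r) s0 ->
  (forall k s, (forall x, x != r -> ~~ writes x c -> reg s x = reg s0 x) ->
     (forall a, ~~ stores a c -> arr s a = arr s0 a) ->
     I k.+1 s -> reg s r = k.+1 -> k < reg s0 r ->
     I k (set_reg (sem c s) r k) /\ cost c s <= b) ->
  I 0 (sem (Loop r c) s0) /\ cost (Loop r c) s0 <= reg s0 r * (b + 4) + 1.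
Proof.
move=> I0 step /=.
pose J k s := [/\ I k s, reg s r = k,
  forall x, x != r -> ~~ writes x c -> reg s x = reg s0 x
  & forall a, ~~ stores a c -> arr s a = arr s0 a].
suff h n s : n <= reg s0 r -> J n s ->
    I 0 (loop_sem (sem c) r n s) /\ loop_cost (sem c) (cost c) r n s <= n * (b + 4) + 1.
  by apply: h => //; split.
elim: n s => [|n IH] s lten [In sr fr fa] //=.
have [In' costb] := step n s fr fa In sr lten.
have [|] := IH (set_reg (sem c s) r n) (ltnW lten).
  split=> // [|x nx wx|a sa]; rewrite /= ?/upd ?eqxx //.
    by rewrite (negPf nx) writes_sem ?fr.
  by rewrite stores_sem ?fa.
by move=> I0' costl; split=> //; lia.
Qed.

(* Register 4 holds 1 and register 21 holds 0; registers 1, 2 and 3 hold the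
   numbers of candidates other than p, of manipulators and of given votes.
   Array 0 holds the input words (from index 1 on), array 1 the capacities,
   array 2 the powers of t + 1 and array 3 the table. *)
Definition column_cmd : cmd :=
  (Const 6 0;; Add 10 3 21);;
  Loop 10 (Get 7 0 5;; Add 6 6 7;; Add 5 5 22).

(** The scores of [p] start at index 4 and those of candidate [c] at [5 + c], with stride [m.+1] in
    register 22. The last command stores the sentinel capacity 1 at index [m]. *)
Definition capacities_cmd : cmd :=
  ((Const 5 4;; column_cmd);; Add 11 6 21;; Add 9 1 21);;
  Loop 9 (Add 11 11 2);;
  (Const 8 0;; Add 9 1 21);;
  Loop 9 ((Const 5 5;; Add 5 5 8);; column_cmd;; Sub 7 11 6;; Put 1 8 7;; Add 8 8 4);;
  Put 1 8 4.

(** Hall's condition for [t = 1]: register 5 is the threshold, register 6 counts the capacities not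
    above it. Truncated subtraction does the comparing. *)
Definition count_cmd : cmd :=
  (Const 0 1;; Const 5 0;; Add 9 1 21);;
  Loop 9 ((Const 6 0;; Const 8 0;; Add 10 1 21);;
          Loop 10 (Get 7 1 8;; Sub 20 7 5;; If 20 Skip (Add 6 6 4);; Add 8 8 4);;
          Sub 20 6 5;; If 20 (Const 0 0) Skip;; Add 5 5 4).

(** Adding the old power [t] times multiplies it by [t + 1]; register 18 ends with the size of the
    table. *)
Definition powers_cmd : cmd :=
  (Const 18 1;; Const 12 0;; Add 9 1 21);;
  Loop 9 ((Put 2 12 18;; Add 20 18 21;; Add 24 2 21);; Loop 24 (Add 18 18 20);; Add 12 12 4).

(** Takes one unit off the current digit, if any is left. Register 14 holds the rest of [N], 18 the
    power, 12 the position, 19 the index of the predecessor and 17 the running maximum. Registers 15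
    and 16 keep remainder and quotient by [t] of the units counted, which replaces a division. *)
Definition unit_cmd : cmd :=
  Add 20 14 4;; Sub 20 20 18;;
  If 20 (Sub 14 14 18;; Add 15 15 4;; Sub 20 2 15;;
         If 20 Skip (Const 15 0;; Add 16 16 4);;
         Get 7 3 19;; Sub 7 7 12;; Sub 20 7 17;; Add 17 17 20)
        Skip.

(** A digit is at most [t], so [t] passes exhaust it. *)
Definition digit_cmd : cmd :=
  (Sub 12 23 4;; Get 18 2 12;; Sub 19 13 18;; Add 24 2 21);; Loop 24 unit_cmd.

(** The conditionals after the loop perform [settle]: a zero in register 15 means that a block is
    complete, and register 16 is then the next candidate. *)
Definition entry_cmd : cmd :=
  (Add 14 13 21;; Const 15 0;; Const 16 0;; Const 17 0;; Add 23 1 21);;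
  Loop 23 digit_cmd;;
  If 15 Skip (If 17 (Get 17 1 16) Skip);;
  Put 3 13 17;; Add 13 13 4.

Definition table_cmd : cmd :=
  powers_cmd;;
  (Get 7 1 21;; Put 3 21 7;; Add 13 4 21;; Sub 9 18 4);;
  Loop 9 entry_cmd;;
  Sub 13 13 4;; Get 0 3 13.

Definition read_cmd : cmd :=
  Const 4 1;; Const 21 0;; Const 0 0;;
  Const 7 1;; Get 1 0 7;; Const 7 2;; Get 2 0 7;; Const 7 3;; Get 3 0 7;; Add 22 1 4.

(** Register 0 starts at 0, the answer for [t = 0]. Without given votes the answer is 1; otherwise
    register 25, holding [t - 1], selects the method. *)
Definition ubm_cmd : cmd :=
  read_cmd;;
  If 2 (If 3 (capacities_cmd;; Sub 25 2 4;; If 25 table_cmd count_cmd) (Const 0 1)) Skip.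

Lemma wf_ubm_cmd : wf ubm_cmd.
Proof. by []. Qed.

(** * Correctness and cost of the subroutines *)

Lemma column_spec s : reg s 21 = 0 ->
  reg (sem column_cmd s) 6 = \sum_(0 <= v < reg s 3) arr s 0 (reg s 5 + v * reg s 22) /\
  cost column_cmd s <= 13 * reg s 3 + 3.
Proof.
move=> zero; rewrite /column_cmd.
set body := (_ ;; _ ;; Add 5 5 22).
set s0 := sem (Const 6 0;; Add 10 3 21) s.
have V0 : reg s0 10 = reg s 3 by rewrite /s0 /= /upd /= zero addn0.
pose I k s' := k <= reg s 3 /\ reg s' 5 = reg s 5 + (reg s 3 - k) * reg s 22 /\
  reg s' 6 = \sum_(0 <= v < reg s 3 - k) arr s 0 (reg s 5 + v * reg s 22).
have [||[_ [_ E]] C] := @loop_rule I 10 body 9 s0.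
- by rewrite V0 /I subnn mul0n addn0 big_geq.
- move=> k s' fr fa [lek [r5 r6]] r10 ltk.
  split=> //; rewrite /I /= /upd /= r5 r6 (fa 0 isT) (fr 22 isT isT) /= /upd /=.
  have -> : reg s 3 - k = (reg s 3 - k.+1).+1 by lia.
  by split; [lia|split; [lia|rewrite big_nat_recr]].
split; first by move: E; rewrite subn0 /=.
change (2 + cost (Loop 10 body) s0 <= 13 * reg s 3 + 3).
by rewrite V0 in C; lia.
Qed.

Definition column (s : state) (k : nat) : nat :=
  \sum_(0 <= v < reg s 3) arr s 0 (k + v * reg s 22).

Lemma capacities_spec s : reg s 21 = 0 -> reg s 4 = 1 ->
  let s' := sem capacities_cmd s in
  [/\ forall c, c < reg s 1 -> arr s' 1 c = column s 4 + reg s 1 * reg s 2 - column s (5 + c),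
      arr s' 1 (reg s 1) = 1
    & cost capacities_cmd s <= reg s 1 * (13 * reg s 3 + 30) + 13 * reg s 3 + 30].
Proof.
move=> zero one; rewrite /capacities_cmd.
have wcol x : writes x column_cmd = (x \in [:: 5; 6; 7; 10]).
  by rewrite !inE /= !(eq_sym x); do 4?[case: eqP => //=].
have scol a : ~~ stores a column_cmd by [].
(* The subroutine is generalised to a variable known by its specification and frame, and the
   intermediate states get opaque names; otherwise simplification would unfold whole runs. *)
move: column_cmd column_spec wcol scol => col colP wcol scol.
have rcol x s' : x \notin [:: 5; 6; 7; 10] -> reg (sem col s') x = reg s' x.
  by move=> nx; rewrite writes_sem ?wcol.
have acol a s' : arr (sem col s') a = arr s' a by apply: stores_sem.
set c1 := (_ ;; _ ;; Add 9 1 21); set body := (_ ;; col ;; _).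
set m := reg s 1; set t := reg s 2.
have [s1 E1] : exists x, x = sem c1 s by exists (sem c1 s).
have [s2 E2] : exists x, x = sem (Loop 9 (Add 11 11 2)) s1 by eexists.
have [s3 E3] : exists x, x = sem (Const 8 0;; Add 9 1 21) s2 by eexists.
have [s4 E4] : exists x, x = sem (Loop 9 body) s3 by eexists.
have [col1 cost1] := colP (sem (Const 5 4) s) zero.
have C1 : cost c1 s <= 13 * reg s 3 + 6 by move: cost1; rewrite /= /upd /=; lia.
have r11 : reg s1 11 = column s 4.
  by rewrite E1 /= /upd /= [X in X + _]col1 rcol //= /upd /= zero addn0.
have r19 : reg s1 9 = m by rewrite E1 /= /upd /= !rcol //= /upd /= zero addn0.
have w1 x : x \notin [:: 5; 6; 7; 9; 10; 11] -> reg s1 x = reg s x.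
  move=> nx; rewrite E1 writes_sem //= wcol; move: nx; rewrite !inE; lia.
have [||r211 C2] := @loop_rule (fun k s' => reg s' 11 + k * t = column s 4 + m * t) 9 (Add 11 11 2) 1 s1.
- by rewrite r19 /= r11.
- by move=> k s' fr fa Hk _ _; split=> //=; rewrite /upd /= (fr 2 isT isT) w1 // -/t; lia.
have w2 x : x \notin [:: 5; 6; 7; 9; 10; 11] -> reg s2 x = reg s x.
  by move=> nx; rewrite E2 writes_sem ?w1 //=; move: nx; rewrite !inE; lia.
have a3 a : arr s3 a = arr s a.
  by rewrite E3 /= E2 stores_sem // E1 /= acol.
have w3 x : x \notin [:: 5; 6; 7; 8; 9; 10; 11] -> reg s3 x = reg s x.
  by move=> nx; rewrite E3 writes_sem ?w2 //=; move: nx; rewrite !inE; lia.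
have r311 : reg s3 11 = column s 4 + m * t.
  by rewrite E3 /= /upd /= -r211 -E2 mul0n addn0.
have r39 : reg s3 9 = m by rewrite E3 /= /upd /= !w2 // zero addn0.
pose I k s' := reg s' 8 = m - k /\ k <= m /\
  forall c, c < m - k -> arr s' 1 c = column s 4 + m * t - column s (5 + c).
have [||[r48 [_ cap]] C4] := @loop_rule I 9 body (13 * reg s 3 + 14) s3.
- by rewrite r39 /I subnn; split=> //; rewrite E3 /= /upd.
- move=> k s' fr fa [r8 [lek Hc]] r9 _.
  have fw x : x \notin [:: 5; 6; 7; 8; 9; 10] -> reg s' x = reg s3 x.
    by move=> nx; apply: fr; rewrite ?wcol /=; move: nx; rewrite ?wcol !inE; lia.
  have fa0 : arr s' 0 = arr s3 0 by apply: fa; rewrite /= (negPf (scol 0)).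
  have [col2 cost2] := colP (sem (Const 5 5;; Add 5 5 8) s') (etrans (fw 21 isT) (etrans (w3 21 isT) zero)).
  have colE : reg (sem col (sem (Const 5 5;; Add 5 5 8) s')) 6 = column s (5 + (m - k.+1)).
    by rewrite col2 /column /= /upd /= r8 (fw 3 isT) (fw 22 isT) !w3 // fa0 a3.
  rewrite /= /upd /= r8 in colE.
  have mk : m - k = (m - k.+1).+1 by lia.
  split; last first.
    by move: cost2; rewrite /= /upd /= (fw 3 isT) w3 //; lia.
  rewrite /I /= /upd /= mk; split; first by rewrite !rcol //= /upd /= r8 (fw 4 isT) w3 // one addn1.
  split=> [|c]; first by lia.
  rewrite (rcol 8 _ isT) (rcol 11 _ isT) /= /upd /= r8 ltnS leq_eqVlt; case: eqP => [-> _|ne /= ltc].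
    by rewrite [X in _ - X]colE (fw 11 isT) r311.
  by rewrite acol /=; apply: Hc.
rewrite -E4 subn0 in r48 cap.
have a6 : arr (sem (Put 1 8 4) s4) 1 = upd (arr s4 1) m 1.
  rewrite /= r48; congr upd.
  by rewrite E4 writes_sem ?w3 //= wcol.
have -> : sem (c1;; Loop 9 (Add 11 11 2);; (Const 8 0;; Add 9 1 21);; Loop 9 body;; Put 1 8 4) s
  = sem (Put 1 8 4) s4 by rewrite E4 E3 E2 E1.
have -> : cost (c1;; Loop 9 (Add 11 11 2);; (Const 8 0;; Add 9 1 21);; Loop 9 body;; Put 1 8 4) s
  = cost c1 s + (cost (Loop 9 (Add 11 11 2)) s1 + (2 + (cost (Loop 9 body) s3 + 7)))
  by rewrite E3 E2 E1.
split=> [c ltc||].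
- by rewrite a6 /upd ifN_eq ?cap // neq_ltn ltc.
- by rewrite a6 /upd eqxx.
rewrite r19 in C2; rewrite r39 in C4; nia.
Qed.

Lemma count_spec s : reg s 21 = 0 -> reg s 4 = 1 ->
  (reg (sem count_cmd s) 0 != 0 <->
   forall k, k < reg s 1 -> \sum_(0 <= c < reg s 1) (arr s 1 c <= k) <= k) /\
  cost count_cmd s <= reg s 1 * (reg s 1 * 16 + 20) + 10.
Proof.
move=> zero one; rewrite /count_cmd; set m := reg s 1; pose cap := arr s 1.
set inner := (_ ;; _ ;; _ ;; Add 8 8 4); set body := (_ ;; Loop 10 inner ;; _).
have innerP s' : reg s' 4 = 1 -> reg s' 6 = 0 -> reg s' 8 = 0 ->
    reg (sem (Loop 10 inner) s') 6 = \sum_(0 <= c < reg s' 10) (arr s' 1 c <= reg s' 5) /\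
    cost (Loop 10 inner) s' <= reg s' 10 * 16 + 1.
  move=> one' r6 r8.
  pose I k s1 := [/\ k <= reg s' 10, reg s1 8 = reg s' 10 - k &
    reg s1 6 = \sum_(0 <= c < reg s' 10 - k) (arr s' 1 c <= reg s' 5)].
  have [||[_ _ E] C] := @loop_rule I 10 inner 12 s'.
  - by rewrite /I subnn big_geq.
  - move=> k s1 fr fa [lek r8' r6'] r10 _.
    have kE : reg s' 10 - k = (reg s' 10 - k.+1).+1 by lia.
    have E4 := fr 4 isT isT; have E5 := fr 5 isT isT; have Ea := fa 1 isT.
    rewrite /I kE big_nat_recr //= /upd /= r8' Ea E5 subn_eq0.
    case: (leqP (arr s' 1 _) (reg s' 5)) => _; rewrite /= /upd /= E4 one' r6' r8'; split=> //; split=> //; lia.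
  by rewrite subn0 in E.
pose Q n := forall k, k < n -> \sum_(0 <= c < m) (cap c <= k) <= k.
have [s1 E1] : exists x, x = sem (Const 0 1;; Const 5 0;; Add 9 1 21) s by eexists.
have r19 : reg s1 9 = m by rewrite E1 /= /upd /= zero addn0.
(* The flag in register 0 survives exactly when all thresholds below [m - k] pass. *)
pose I k s' := [/\ k <= m, reg s' 5 = m - k & reg s' 0 != 0 <-> Q (m - k)].
have [||[_ _ E] C] := @loop_rule I 9 body (m * 16 + 14) s1.
- by rewrite /I r19 subnn E1.
- move=> k s' fr fa [lek r5 Qk] r9 _.
  have E4 : reg s' 4 = 1 by rewrite (fr 4 isT isT) E1.
  have [s2 E2] : exists x, x = sem (Const 6 0;; Const 8 0;; Add 10 1 21) s' by eexists.
  have r210 : reg s2 10 = m.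
    by rewrite E2 /= /upd /= (fr 1 isT isT) (fr 21 isT isT) E1 /= /upd /= zero addn0.
  have [|||n6 C2] := innerP s2; [by rewrite E2..|].
  have a2 : arr s2 1 = cap by rewrite E2 /= fa // E1.
  have r25 : reg s2 5 = m - k.+1 by rewrite E2.
  have [s3 E3] : exists x, x = sem (Loop 10 inner) s2 by eexists.
  have r34 : reg s3 4 = 1 by rewrite E3 writes_sem // E2.
  have r35 : reg s3 5 = m - k.+1 by rewrite E3 writes_sem.
  have r30 : reg s3 0 = reg s' 0 by rewrite E3 writes_sem // E2.
  rewrite -E3 r210 a2 r25 in n6.
  have -> : sem body s' = sem (Sub 20 6 5;; If 20 (Const 0 0) Skip;; Add 5 5 4) s3.
    by rewrite E3 E2.
  have -> : cost body s' = 3 + (cost (Loop 10 inner) s2 +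
      cost (Sub 20 6 5;; If 20 (Const 0 0) Skip;; Add 5 5 4) s3) by rewrite E3 E2.
  have kE : m - k = (m - k.+1).+1 by lia.
  rewrite r210 in C2.
  have QS : Q (m - k) <-> Q (m - k.+1) /\ \sum_(0 <= c < m) (cap c <= m - k.+1) <= m - k.+1.
    rewrite kE; split=> [h|[h1 h2] j].
      by split=> [j ltj|]; apply: h; lia.
    by rewrite ltnS leq_eqVlt => /orP[/eqP->|/h1].
  move: (cost (Loop 10 inner) s2) C2 => K C2.
  rewrite /I /= /upd /= n6 r35 subn_eq0.
  case: (leqP (\sum_(0 <= c < m) _) (m - k.+1)) => cmp /=; rewrite /upd /= ?r30 ?r34 r35.
    split; [split; [lia|lia|apply: iff_trans (iff_sym QS)]|lia].
    by split=> [h|[h _]]; [split=> //|]; apply/Qk.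
  split; [split; [lia|lia|apply: iff_trans (iff_sym QS)]|lia].
  by split=> // -[_]; rewrite leqNgt cmp.
have -> : sem ((Const 0 1;; Const 5 0;; Add 9 1 21);; Loop 9 body) s = sem (Loop 9 body) s1.
  by rewrite E1.
have -> : cost ((Const 0 1;; Const 5 0;; Add 9 1 21);; Loop 9 body) s = 3 + cost (Loop 9 body) s1.
  by rewrite E1.
rewrite subn0 in E; split=> //; rewrite r19 in C; nia.
Qed.

Lemma powers_spec s : reg s 21 = 0 -> reg s 4 = 1 ->
  let s' := sem powers_cmd s in
  [/\ forall j, j < reg s 1 -> arr s' 2 j = (reg s 2).+1 ^ j,
      reg s' 18 = (reg s 2).+1 ^ reg s 1
    & cost powers_cmd s <= reg s 1 * (reg s 2 * 5 + 20) + 10].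
Proof.
move=> zero one; rewrite /powers_cmd; set m := reg s 1; set t := reg s 2.
set pre := (Put 2 12 18 ;; _); set body := (pre ;; _).
have [s1 E1] : exists x, x = sem (Const 18 1;; Const 12 0;; Add 9 1 21) s by eexists.
have r19 : reg s1 9 = m by rewrite E1 /= /upd /= zero addn0.
pose I k s' := [/\ k <= m, reg s' 12 = m - k, reg s' 18 = t.+1 ^ (m - k)
  & forall j, j < m - k -> arr s' 2 j = t.+1 ^ j].
have [||[_ _ E a] C] := @loop_rule I 9 body (t * 5 + 15) s1.
- by rewrite /I r19 subnn E1.
- move=> k s' fr fa [lek r12 r18 Hj] r9 _.
  have E4 : reg s' 4 = 1 by rewrite (fr 4 isT isT) E1.
  have [s2 E2] : exists x, x = sem pre s' by eexists.
  have r224 : reg s2 24 = t.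
    by rewrite E2 /= /upd /= (fr 2 isT isT) (fr 21 isT isT) E1 /= /upd /= zero addn0.
  have r220 : reg s2 20 = t.+1 ^ (m - k.+1).
    by rewrite E2 /= /upd /= r18 (fr 21 isT isT) E1 /= /upd /= zero addn0.
  have r218 : reg s2 18 = t.+1 ^ (m - k.+1) by rewrite E2.
  have [||E18 C2] := @loop_rule (fun n s3 => reg s3 18 + n * t.+1 ^ (m - k.+1) = t.+1 ^ (m - k))
    24 (Add 18 18 20) 1 s2.
  - by rewrite r224 r218 (_ : m - k = (m - k.+1).+1) ?expnS ?mulSn //; lia.
  - move=> n s3 fr3 fa3 H3 _ _; split=> //=.
    by rewrite /upd /= (fr3 20 isT isT) r220 -H3 mulSn addnA.
  have [s3 E3] : exists x, x = sem (Loop 24 (Add 18 18 20)) s2 by eexists.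
  have -> : sem body s' = sem (Add 12 12 4) s3 by rewrite E3 E2.
  have -> : cost body s' = 9 + (cost (Loop 24 (Add 18 18 20)) s2 + 1) by rewrite E2.
  rewrite r224 in C2; split; last by lia.
  rewrite /I /= /upd /= (_ : reg s3 12 = reg s' 12); last by rewrite E3 writes_sem // E2.
  rewrite (_ : reg s3 4 = 1); last by rewrite E3 writes_sem // E2.
  split; [lia|lia|by rewrite -E18 -E3 mul0n addn0|move=> j].
  rewrite (_ : m - k = (m - k.+1).+1); last by lia.
  rewrite E3 stores_sem // E2 /= /upd /= r12 ltnS leq_eqVlt.
  by case: eqP => [-> _|_ /= /Hj].
have -> : sem ((Const 18 1;; Const 12 0;; Add 9 1 21);; Loop 9 body) s = sem (Loop 9 body) s1.
  by rewrite E1.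
have -> : cost ((Const 18 1;; Const 12 0;; Add 9 1 21);; Loop 9 body) s = 3 + cost (Loop 9 body) s1.
  by rewrite E1.
by rewrite subn0 in E a; split=> //; rewrite r19 in C; nia.
Qed.

Lemma unit_spec s : reg s 4 = 1 -> reg s 15 < reg s 2 ->
  let s' := sem unit_cmd s in let b := reg s 18 <= reg s 14 in
  [/\ reg s' 14 = reg s 14 - b * reg s 18,
      reg s' 15 + reg s 2 * reg s' 16 = reg s 15 + reg s 2 * reg s 16 + b,
      reg s' 15 < reg s 2,
      reg s' 17 = (if b then maxn (reg s 17) (arr s 3 (reg s 19) - reg s 12) else reg s 17)
    & cost unit_cmd s <= 25].
Proof.
move=> one lt15 s' b.
pose s1 := sem (Add 20 14 4;; Sub 20 20 18) s.
have r20 : (reg s1 20 == 0) = ~~ b.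
  by rewrite /s1 /= /upd /= one /b; lia.
rewrite /s' /unit_cmd; set hit := (Sub 14 14 18 ;; _).
have -> : sem (Add 20 14 4;; Sub 20 20 18;; If 20 hit Skip) s = if b then sem hit s1 else s1.
  by rewrite -[LHS]/(if reg s1 20 == 0 then s1 else sem hit s1) r20 if_neg.
have -> : cost (Add 20 14 4;; Sub 20 20 18;; If 20 hit Skip) s =
    2 + if b then (cost hit s1).+2 else 1.
  by rewrite -[LHS]/(1 + (1 + if reg s1 20 == 0 then 1 else (cost hit s1).+2)) r20 if_neg.
case: b {r20}; last by split; rewrite /s1 //= /upd /=; lia.
pose s2 := sem (Sub 14 14 18;; Add 15 15 4;; Sub 20 2 15) s1.
pose upd_max := Get 7 3 19;; Sub 7 7 12;; Sub 20 7 17;; Add 17 17 20.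
have r20 : (reg s2 20 == 0) = (reg s 15 + 1 == reg s 2).
  by rewrite /s2 /s1 /= /upd /= one; lia.
have -> : sem hit s1 = sem upd_max (if reg s 15 + 1 == reg s 2
    then sem (Const 15 0;; Add 16 16 4) s2 else s2).
  by rewrite -r20.
have -> : cost hit s1 = 3 + ((if reg s 15 + 1 == reg s 2 then 3 else 2) + 10).
  by rewrite -r20.
case: eqP => [E|ne]; rewrite /= /upd /= one; split; lia.
Qed.

Lemma digit_spec s j d R : reg s 4 = 1 -> reg s 21 = 0 -> reg s 23 = j.+1 ->
  reg s 15 < reg s 2 -> d <= reg s 2 -> R < arr s 2 j -> reg s 14 = d * arr s 2 j + R ->
  let s' := sem digit_cmd s in
  [/\ reg s' 14 = R,
      reg s' 15 + reg s 2 * reg s' 16 = reg s 15 + reg s 2 * reg s 16 + d,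
      reg s' 15 < reg s 2,
      reg s' 17 = (if 0 < d then maxn (reg s 17) (arr s 3 (reg s 13 - arr s 2 j) - j)
                   else reg s 17)
    & cost digit_cmd s <= reg s 2 * 29 + 20].
Proof.
move=> one zero r23 lt15 led ltR r14; rewrite /digit_cmd.
have wunit x : x \notin [:: 14; 15; 20; 16; 7; 17] -> ~~ writes x unit_cmd.
  by rewrite !inE /= !(eq_sym x); lia.
have sunit a : ~~ stores a unit_cmd by [].
move: unit_cmd unit_spec wunit sunit => unit unitP wunit sunit.
have [s1 E1] : exists x, x = sem (Sub 12 23 4;; Get 18 2 12;; Sub 19 13 18;; Add 24 2 21) s.
  by eexists.
set t := reg s 2; set pw := arr s 2 j; set x := arr s 3 _ - j.
have r12 : reg s1 12 = j by rewrite E1 /= /upd /= r23 one subn1.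
have r18 : reg s1 18 = pw by rewrite E1 /= /upd /= r23 one subn1.
have r19 : reg s1 19 = reg s 13 - pw by rewrite E1 /= /upd /= r23 one subn1.
have r24 : reg s1 24 = t by rewrite E1 /= /upd /= zero addn0.
(* After [t - k] passes [l] units are gone; once [l = d], the rest [R] is below the power and
   nothing changes. Repeating the maximum with the same [x] is idempotent. *)
pose I k s' := let l := minn (t - k) d in
  [/\ reg s' 14 = (d - l) * pw + R,
      reg s' 15 + t * reg s' 16 = reg s 15 + t * reg s 16 + l,
      reg s' 15 < t &
      reg s' 17 = (if 0 < l then maxn (reg s 17) x else reg s 17)].
have [||[E14 E15 E15' E17] C] := @loop_rule I 24 unit 25 s1.
- by rewrite /I r24 subnn min0n subn0 E1 /= /upd /= r14 addn0.
- move=> k s' fr fa [h14 h15 h15' h17] r24' ltk; rewrite r24 in ltk.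
  have fw y : y \notin [:: 14; 15; 20; 16; 7; 17; 24] -> reg s' y = reg s1 y.
    move=> ny; apply: fr; last apply: wunit; move: ny; rewrite !inE; lia.
  have f2 : reg s' 2 = t by rewrite fw // E1.
  have f4 : reg s' 4 = 1 by rewrite fw // E1.
  have f12 : reg s' 12 = j by rewrite fw.
  have f18 : reg s' 18 = pw by rewrite fw.
  have f19 : reg s' 19 = reg s 13 - pw by rewrite fw.
  have a3 : arr s' 3 = arr s 3 by rewrite fa // E1.
  have [] := unitP s' f4; first by rewrite f2.
  rewrite f2 f12 f18 f19 a3 -/x h14 h15 h17.
  set l := minn (t - k.+1) d; have -> : (pw <= (d - l) * pw + R) = (l < d).
    apply/idP/idP => [|ltl].
      apply: contraTT; rewrite -leqNgt -ltnNge -subn_eq0 => /eqP ->.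
      by rewrite mul0n add0n.
    by rewrite -(subnSK ltl) mulSn -addnA leq_addr.
  move=> g14 g15 g15' g17 cu; split=> //; rewrite /I /= /upd /= g14 g15 g17.
  have lE : minn (t - k) d = l + (l < d) by rewrite /l; lia.
  rewrite lE; split=> //.
  + case: (ltnP l d) => ltl; rewrite /= ?mul1n ?mul0n ?addn0 ?subn0 // addn1.
    by rewrite -(subnSK ltl) mulSn -addnA addKn.
  + by rewrite addnA.
  + by case: (ltnP l d) => ltl; rewrite ?addn0 // addn1 /=; case: ifP => // _; rewrite -maxnA maxnn.
have -> : sem ((Sub 12 23 4;; Get 18 2 12;; Sub 19 13 18;; Add 24 2 21);; Loop 24 unit) s
  = sem (Loop 24 unit) s1 by rewrite E1.
have -> : cost ((Sub 12 23 4;; Get 18 2 12;; Sub 19 13 18;; Add 24 2 21);; Loop 24 unit) s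
  = 10 + cost (Loop 24 unit) s1 by rewrite E1.
rewrite subn0 (minn_idPr led) in E14 E15 E17.
by split=> //; [rewrite E14 subnn mul0n|rewrite r24 in C; lia].
Qed.

Lemma entry_spec s : reg s 4 = 1 -> reg s 21 = 0 -> 0 < reg s 2 ->
  (forall j, j < reg s 1 -> arr s 2 j = (reg s 2).+1 ^ j) ->
  reg s 13 < (reg s 2).+1 ^ reg s 1 ->
  let s' := sem entry_cmd s in
  [/\ arr s' 3 = upd (arr s 3) (reg s 13)
        (table_step (reg s 1) (reg s 2) (arr s 1) (arr s 3) (reg s 13)),
      reg s' 13 = (reg s 13).+1
    & cost entry_cmd s <= reg s 1 * (reg s 2 * 29 + 24) + 30].
Proof.
move=> one zero t0 powE ltN; rewrite /entry_cmd.
set m := reg s 1; set t := reg s 2; set N := reg s 13; set T := arr s 3; set cap := arr s 1.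
have wdigit x : x \notin [:: 14; 15; 20; 16; 7; 17; 12; 18; 19; 24] -> ~~ writes x digit_cmd.
  by rewrite !inE /= !(eq_sym x); lia.
have sdigit a : ~~ stores a digit_cmd by [].
move: digit_cmd digit_spec wdigit sdigit => dig digP wdig sdig.
set pre := (Add 14 13 21;; _).
have [s1 E1] : exists x, x = sem pre s by eexists.
have r23 : reg s1 23 = m by rewrite E1 /= /upd /= zero addn0.
(* Digits are read from the most significant one down: positions from [k] on are done, the lower
   part remains. *)
pose I k s' := [/\ reg s' 14 = N %% t.+1 ^ k,
  reg s' 15 + t * reg s' 16 = \sum_(k <= j < m) digit t.+1 N j, reg s' 15 < t &
  reg s' 17 = \max_(k <= j < m | 0 < digit t.+1 N j) (T (N - t.+1 ^ j) - j)].
have fw s' : (forall x, x != 23 -> ~~ writes x dig -> reg s' x = reg s1 x) ->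
    forall y, y \in [:: 1; 2; 4; 13; 21] -> reg s' y = reg s y.
  move=> fr y yin; rewrite fr; last apply: wdig.
  - by move: yin; rewrite E1 !inE => /or4P[/eqP->|/eqP->|/eqP->|/orP[/eqP->|/eqP->]].
  - by move: yin; rewrite !inE; lia.
  - by move: yin; rewrite !inE; lia.
have [||[E14 E15 E15' E17] C] := @loop_rule I 23 dig (t * 29 + 20) s1.
- rewrite /I r23 !big_geq // E1 /= /upd /= zero addn0 modn_small //.
  by rewrite muln0.
- move=> k s' fr fa [h14 h15 h15' h17] r23' ltk; rewrite r23 in ltk.
  have fy := fw s' fr.
  have aE a : arr s' a = arr s a by rewrite fa // E1.
  have powk : arr s' 2 k = t.+1 ^ k by rewrite aE powE.
  have [|||||||] := @digP s' k (digit t.+1 N k) (N %% t.+1 ^ k).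
  + by rewrite fy.
  + by rewrite fy.
  + by [].
  + by rewrite [reg s' 2]fy.
  + by rewrite [reg s' 2]fy // -ltnS ltn_pmod.
  + by rewrite powk ltn_pmod // expn_gt0.
  + by rewrite powk h14 modn_digit.
  rewrite powk aE (fy 2 isT) (fy 13 isT) h15 h17 -/t -/T -/N => g14 g15 g15' g17 cd.
  split=> //; rewrite /I /= /upd /= g14 g15 g17; split=> //.
    by rewrite [RHS]big_ltn // addnC.
  by rewrite [RHS]big_ltn_cond //; case: ifP => // _; rewrite maxnC.
have [s2 E2] : exists x, x = sem (Loop 23 dig) s1 by eexists.
rewrite -E2 in E14 E15 E15' E17.
have r2 y : y \in [:: 1; 2; 4; 13; 21] -> reg s2 y = reg s y.
  by apply: fw => x n23 wx; rewrite E2 writes_sem //= negb_or eq_sym n23.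
have aE a : arr s2 a = arr s a by rewrite E2 (stores_sem _ (sdig a : ~~ stores a (Loop 23 dig))) E1.
set post := (If 15 _ _;; _).
have -> : sem (pre;; Loop 23 dig;; post) s = sem post s2 by rewrite E2 E1.
have -> : cost (pre;; Loop 23 dig;; post) s = 5 + (cost (Loop 23 dig) s1 + cost post s2).
  by rewrite E2 E1.
pose s3 := sem (If 15 Skip (If 17 (Get 17 1 16) Skip)) s2.
have r3 y : y != 17 -> reg s3 y = reg s2 y by move=> y17; rewrite writes_sem //= orbF eq_sym.
have a3 a : arr s3 a = arr s a by rewrite /s3 stores_sem.
have val3 : reg s3 17 = table_step m t cap T N.
  rewrite /table_step /settle -E15 -E17 dvdn_addl ?dvdn_mulr //.
  rewrite addnC mulnC divnMDl // (divn_small E15') addn0 /s3 /=.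
  case: (posnP (reg s2 15)) => [->|r15] /=; last by rewrite gtnNdvd // ifN_eq ?lt0n_neq0 // -lt0n.
  by rewrite dvdn0; case: posnP => [->|] //=; rewrite /upd /= aE.
split.
- change (upd (arr s3 3) (reg s3 13) (reg s3 17) = upd T N (table_step m t cap T N)).
  by rewrite val3 a3 r3 // r2.
- change (reg s3 13 + reg s3 4 = N.+1).
  by rewrite !r3 // !r2 // one addn1.
have cp : cost post s2 <= 20.
  by rewrite /post /=; case: ifP => _; try case: ifP => _.
by rewrite r23 in C; lia.
Qed.

(** An entry depends on smaller indices only, so writing later entries into the same array keeps the
    recursion valid. *)
Lemma table_step_ext m t cap T T' N : 0 < N -> (forall M, M < N -> T M = T' M) ->
  table_step m t cap T N = table_step m t cap T' N.
Proof.
move=> N0 eqT; rewrite /table_step; congr settle; apply: eq_bigr => j _.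
by rewrite eqT // ltn_subrL N0 expn_gt0.
Qed.

Lemma table_spec s : reg s 4 = 1 -> reg s 21 = 0 -> 0 < reg s 2 ->
  let P := (reg s 2).+1 ^ reg s 1 in
  (exists2 T, is_table (reg s 1) (reg s 2) (arr s 1) T
     & reg (sem table_cmd s) 0 = T P.-1) /\
  cost table_cmd s <= P * (reg s 1 * (reg s 2 * 34 + 44) + 100).
Proof.
move=> one zero t0; rewrite /table_cmd.
set m := reg s 1; set t := reg s 2; set cap := arr s 1; pose P := t.+1 ^ m; rewrite -/P.
have P0 : 0 < P by rewrite expn_gt0.
have wpow x : x \in [:: 1; 2; 4; 21] -> ~~ writes x powers_cmd.
  by rewrite !inE => /or4P[] /eqP ->.
have spow a : a != 2 -> ~~ stores a powers_cmd by rewrite /= !orbF eq_sym.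
have wentry x : x \in [:: 1; 2; 4; 21] -> ~~ writes x entry_cmd.
  by rewrite !inE => /or4P[] /eqP ->.
have sentry a : a != 3 -> ~~ stores a entry_cmd by rewrite /= !orbF eq_sym.
move: powers_cmd (powers_spec zero one) entry_cmd entry_spec wpow spow wentry sentry.
move=> pow [powE r18 costp] ent entP wpow spow went sent.
set init := (Get 7 1 21;; _).
have [s1 E1] : exists x, x = sem pow s by eexists.
rewrite -E1 in powE r18.
have [s2 E2] : exists x, x = sem init s1 by eexists.
have r1 x : x \in [:: 1; 2; 4; 21] -> reg s1 x = reg s x.
  by move=> xin; rewrite E1 writes_sem ?wpow.
have r2 x : x \in [:: 1; 2; 4; 21] -> reg s2 x = reg s x.
  move=> xin; rewrite E2 writes_sem ?r1 //=; move: xin; rewrite !inE; lia.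
have a1 a : a != 2 -> arr s1 a = arr s a by move=> na; rewrite E1 stores_sem ?spow.
have a2 a : a != 3 -> arr s2 a = arr s1 a.
  by move=> na; rewrite E2 stores_sem //= orbF eq_sym.
have r29 : reg s2 9 = P - 1 by rewrite E2 /= /upd /= r18 r1 // one.
(* The entries below [P - k] satisfy the recursion; entry 0 is set beforehand, which leaves [P - 1]
   passes. *)
pose I k s' := [/\ k < P, reg s' 13 = P - k, arr s' 3 0 = cap 0 &
  forall N, 0 < N < P - k -> arr s' 3 N = table_step m t cap (arr s' 3) N].
have [||[_ E13 ET0 ET] C] := @loop_rule I 9 ent (m * (t * 29 + 24) + 30) s2.
- rewrite /I r29; split; first by lia.
  + by rewrite E2 /= /upd /= !r1 // zero one; lia.
  + by rewrite E2 /= /upd /= !r1 // zero /= a1.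
  + by move=> N; lia.
- move=> k s' fr fa [ltk r13 T0 TN] r9 _.
  have fx x : x \in [:: 1; 2; 4; 21] -> reg s' x = reg s x.
    move=> xin; rewrite fr ?r2 ?went //; move: xin; rewrite !inE; lia.
  have fa' a : a != 3 -> arr s' a = arr s1 a by move=> na; rewrite fa ?a2 ?sent.
  have [|||||aE r13' ce] := entP s'.
  + by rewrite fx.
  + by rewrite fx.
  + by rewrite fx.
  + by move=> j; rewrite (fx 1 isT) (fx 2 isT) (fa' 2 isT); apply: powE.
  + by rewrite (fx 1 isT) (fx 2 isT) r13 -/m -/t -/P; lia.
  move: aE ce; rewrite (fx 1 isT) (fx 2 isT) (fa' 1 isT) (a1 1 isT) -/m -/t -/cap r13 => aE ce.
  split=> //; rewrite /I /= /upd /= r13' r13 aE; split.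
  + by lia.
  + by lia.
  + by rewrite /upd ifN_eq //; lia.
  move=> N HN; rewrite (@table_step_ext _ _ _ _ (arr s' 3)); last 2 first.
  + by lia.
  + by move=> M ltM; rewrite /upd ifN_eq //; lia.
  rewrite /upd; case: eqP => [->//|ne]; apply: TN; lia.
have [s3 E3] : exists x, x = sem (Loop 9 ent) s2 by eexists.
rewrite -E3 subn0 in E13 ET0 ET.
split.
  exists (arr s3 3); first by split=> // N N0 ltN; apply: ET; rewrite N0.
  have -> : sem (pow;; init;; Loop 9 ent;; Sub 13 13 4;; Get 0 3 13) s =
    sem (Sub 13 13 4;; Get 0 3 13) s3 by rewrite E3 E2 E1.
  rewrite /= /upd /= E13 (_ : reg s3 4 = 1) ?subn1 //.
  by rewrite E3 writes_sem ?r2 //= went.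
have -> : cost (pow;; init;; Loop 9 ent;; Sub 13 13 4;; Get 0 3 13) s =
    cost pow s + (16 + (cost (Loop 9 ent) s2 + 8)) by rewrite E2 E1.
move: C costp; rewrite r29 -/m -/t.
move: (cost _ _) (cost _ _) => c1 c2 h1 h2.
have h3 : m * (t * 5 + 20) + 10 <= P * (m * (t * 5 + 20) + 10) by apply: leq_pmull.
have h4 : (P - 1) * (m * (t * 29 + 24) + 30 + 4) <= P * (m * (t * 29 + 24) + 34).
  by apply: leq_mul; [exact: leq_subr|rewrite -addnA].
have -> : P * (m * (t * 34 + 44) + 100) =
  P * (m * (t * 5 + 20) + 10) + P * (m * (t * 29 + 24) + 34) + P * 56 by lia.
lia.
Qed.

(** * Encoded instances and the final time bound *)

Lemma nth_flatten_rect (T : Type) (x0 : T) (k : nat) (ss : seq (seq T)) v c :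
  all (fun s => size s == k) ss -> v < size ss -> c < k ->
  nth x0 (flatten ss) (v * k + c) = nth x0 (nth [::] ss v) c.
Proof.
elim: ss v => [|s ss IH] [|v] //= /andP[/eqP szs szss] ltv ltc; rewrite nth_cat szs.
  by rewrite mul0n add0n ltc.
by rewrite ifF ?mulSn -?addnA ?addKn ?IH //; lia.
Qed.

Lemma size_encode I : size (ubm_encode I) = 3 + size (ubm_votes I) * (ubm_m I).+1.
Proof.
rewrite /ubm_encode size_cat; congr (_ + _); elim: (ubm_votes I) => //= v V IH.
by rewrite size_cat IH size_map size_enum_ord mulSn.
Qed.

Lemma nth_encode I v (c : 'I_(ubm_m I).+1) : v < size (ubm_votes I) ->
  nth 0 (ubm_encode I) (3 + c + v * (ubm_m I).+1) = nth 1%g (ubm_votes I) v c.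
Proof.
move=> ltv; rewrite /ubm_encode -addnA [c + _]addnC /= nth_flatten_rect ?size_map //.
  rewrite (nth_map 1%g) // (nth_map ord0) ?size_enum_ord //.
  by rewrite nth_ord_enum.
by apply/allP => _ /mapP[w _ ->]; rewrite size_map size_enum_ord.
Qed.

(** The offset 4 is the header of three words plus one, since array 0 is indexed from 1. *)
Lemma column_bscore (I : ubm_instance) (s : state) (c : 'I_(ubm_m I).+1) :
  (forall j, 0 < j <= size (ubm_encode I) -> arr s 0 j = nth 0 (ubm_encode I) j.-1) ->
  reg s 3 = size (ubm_votes I) -> reg s 22 = (ubm_m I).+1 ->
  column s (4 + c) = bscore (ubm_votes I) c.
Proof.
move=> inpE r3 r22; rewrite /column r3 r22 /bscore [RHS](big_nth 1%g).
rewrite !big_mkord; apply: eq_bigr => v _; rewrite inpE.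
  exact: nth_encode.
have ltv : v < size (ubm_votes I) := ltn_ord v.
have : v.+1 * (ubm_m I).+1 <= size (ubm_votes I) * (ubm_m I).+1 by rewrite leq_mul2r ltv orbT.
by rewrite size_encode mulSn; have := ltn_ord c; lia.
Qed.

(** From [t.+1 <= t ^ 2], which fails for [t = 1]; hence the separate treatment of a single
    manipulator. *)
Lemma expS_le_double (t m : nat) : 1 < t -> t.+1 ^ m <= t ^ (2 * m).
Proof. by move=> t1; rewrite expnM; case: m => // m; rewrite leq_exp2r //; nia. Qed.

Lemma ubm_cmd_spec (I : ubm_instance) (s : state) : ubm_promise I ->
  (forall j, 0 < j <= size (ubm_encode I) -> arr s 0 j = nth 0 (ubm_encode I) j.-1) ->
  cost ubm_cmd s <= 600 * ubm_size I ^ 2 * maxn 1 (ubm_t I) ^ (2 * ubm_m I) /\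
  (reg (sem ubm_cmd s) 0 != 0 <-> ubm_yes I).
Proof.
move=> prom inpE; set m := ubm_m I; set t := ubm_t I; set V := ubm_votes I.
have L3 : 3 <= size (ubm_encode I) by rewrite size_encode; lia.
set W := ubm_size I; set X := maxn 1 t ^ _.
have W3 : 3 <= W by rewrite /W /ubm_size; lia.
have X1 : 0 < X by rewrite expn_gt0; lia.
have WX : 9 <= W ^ 2 * X by nia.
rewrite /ubm_cmd.
have [s1 E1] : exists x, x = sem read_cmd s by eexists.
have r1 : reg s1 1 = m by rewrite E1 /= /upd /= inpE //; lia.
have r2 : reg s1 2 = t by rewrite E1 /= /upd /= inpE //; lia.
have r3 : reg s1 3 = size V by rewrite E1 /= /upd /= inpE //; lia.
have r4 : reg s1 4 = 1 by rewrite E1.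
have r21 : reg s1 21 = 0 by rewrite E1.
have r0 : reg s1 0 = 0 by rewrite E1.
have r22 : reg s1 22 = m.+1 by rewrite -r1 E1 /= /upd /= addn1.
have a1 : arr s1 = arr s by rewrite E1.
set main := If 3 _ _.
have -> : sem (read_cmd;; If 2 main Skip) s = if t == 0 then s1 else sem main s1.
  by rewrite -r2 E1.
have -> : cost (read_cmd;; If 2 main Skip) s = 28 + if t == 0 then 1 else (cost main s1).+2.
  by rewrite -r2 E1.
case: eqP => [t0|/eqP t0].
  (* No manipulators: the votes are unchanged, and by the promise [p] does not win. *)
  split; first by lia.
  rewrite r0; split=> // -[mv [/eqP]].
  by rewrite -/t t0 size_eq0 => /eqP ->; rewrite cats0 => /prom.
rewrite -lt0n in t0.
set big := (capacities_cmd ;; _) in main *.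
have -> : sem main s1 = if size V == 0 then set_reg s1 0 1 else sem big s1.
  by rewrite -r3.
have -> : cost main s1 = if size V == 0 then 2 else (cost big s1).+2.
  by rewrite -r3.
case: eqP => [V0|/eqP V0].
  split; first by lia.
  (* With [t] identity permutations candidate [c] collects [t * c], less than the capacity
     [t * m]. *)
  split=> // _; apply/manipulation_perms; exists (nseq t 1%g); rewrite size_nseq; split=> // c.
  rewrite /capacity -/V -/t -/m (size0nil V0) /bscore !big_nil add0n subn0 big_nseq.
  by rewrite iter_addn_0 perm1 mulnC ltn_mul2l t0 ltn_ord.
rewrite -lt0n in V0.
have wcap x : x \in [:: 1; 2; 3; 4; 21; 22] -> ~~ writes x capacities_cmd.
  by rewrite !inE => /or3P[/eqP->|/eqP->|/or4P[] /eqP->].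
have [cap0 cap1 costc] := capacities_spec r21 r4.
have [s2 E2] : exists x, x = sem (capacities_cmd;; Sub 25 2 4) s1 by eexists.
have r2' x : x \in [:: 1; 2; 3; 4; 21; 22] -> reg s2 x = reg s1 x.
  move=> xin; rewrite E2 -[LHS]/(upd (reg (sem capacities_cmd s1)) 25 _ x) /upd ifF.
    by rewrite writes_sem ?wcap.
  by move: xin; rewrite !inE; lia.
have r225 : (reg s2 25 == 0) = (t == 1).
  rewrite E2 -[reg _ 25]/(reg (sem capacities_cmd s1) 2 - reg (sem capacities_cmd s1) 4).
  by rewrite !writes_sem ?wcap // r2 r4; lia.
have a2 : arr s2 1 = arr (sem capacities_cmd s1) 1 by rewrite E2.
have -> : sem big s1 = if t == 1 then sem count_cmd s2 else sem table_cmd s2.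
  by rewrite -r225 E2.
have -> : cost big s1 = cost capacities_cmd s1 + (1 +
    if t == 1 then (cost count_cmd s2).+1 else (cost table_cmd s2).+2).
  by rewrite -r225 E2.
move: cap0 cap1 costc; rewrite -a2 r1 r2 r3 => cap0 cap1 costc.
have capE (c : 'I_m) : arr s2 1 c = capacity V t c.
  rewrite cap0 // /capacity.
  have inpE1 j : 0 < j <= size (ubm_encode I) -> arr s1 0 j = nth 0 (ubm_encode I) j.-1.
    by rewrite a1; apply: inpE.
  rewrite -(@column_bscore _ s1 (inord c.+1)) // -(@column_bscore _ s1 (pcand _)) //.
  by rewrite inordK ?ltnS // addn0 [m * t]mulnC addSnnS.
have z2 : reg s2 21 = 0 by rewrite r2'.
have o2 : reg s2 4 = 1 by rewrite r2'.
have t2 : reg s2 2 = t by rewrite r2'.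
have m2 : reg s2 1 = m by rewrite r2'.
have yesE : ubm_yes I <-> exists vs : seq {perm 'I_m}, size vs = t /\
    forall c : 'I_m, \sum_(v <- vs) v c < arr s2 1 c.
  apply: iff_trans (manipulation_perms _ _) _.
  by split=> -[vs [szvs lt]]; exists vs; split=> // c; have := lt c; rewrite capE.
have WE : W = 3 + size V * m.+1 + t by rewrite /W /ubm_size size_encode.
(* A given vote takes [m.+1] words of the input, so [m] is bounded by its size. *)
have ltm : m < W by rewrite WE; case: (size V) V0 => //; lia.
have ltV : size V < W by rewrite WE; case: (size V) => //; lia.
have ltt : t < W by rewrite WE; lia.
have capW : cost capacities_cmd s1 <= 100 * W ^ 2 * X.
  apply: leq_trans costc _; apply: leq_trans (leq_pmulr _ X1).
  have : m * size V <= W * W by apply: leq_mul; apply: ltnW.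
  rewrite -mulnn; nia.
case: eqP => [t1|/eqP t1].
  have [ansE costE] := count_spec z2 o2; rewrite m2 in ansE costE.
  split; last first.
    apply: iff_trans ansE _; apply: iff_trans (iff_sym yesE).
    by rewrite t1; apply: iff_sym; apply: single_manipulation.
  suff : cost count_cmd s2 <= 100 * W ^ 2 * X by lia.
  apply: leq_trans costE _; apply: leq_trans (leq_pmulr _ X1).
  have : m * m <= W * W by apply: leq_mul; apply: ltnW.
  rewrite -mulnn; nia.
have [|[T tabT ansE] costE] := table_spec o2 z2; first by rewrite t2.
rewrite t2 m2 in tabT ansE costE.
split; last first.
  rewrite ansE -lt0n; apply: iff_trans (iff_sym yesE).
  by apply: table_manipulation tabT; rewrite ?cap1.
suff : cost table_cmd s2 <= 200 * W ^ 2 * X by lia.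
apply: leq_trans costE _; rewrite mulnC; apply: leq_mul.
  have : m * t <= W * W by apply: leq_mul; apply: ltnW.
  rewrite -mulnn; nia.
by rewrite /X (maxn_idPr t0); apply: expS_le_double; lia.
Qed.

(* UBM is solvable in time O*(t^(2|C|)): some RAM program decides every
   (promise-satisfying) instance within c * size^d * t^(2m) steps. *)
Theorem theorem1 :
  exists (P : program) (c d : nat),
    forall I : ubm_instance, ubm_promise I ->
      decides_within P (ubm_encode I)
        (c * ubm_size I ^ d * maxn 1 (ubm_t I) ^ (2 * ubm_m I))
        (ubm_yes I).
Proof.
(* The constant 1000 is 600 for the command plus 400 for the relocation. *)
exists (relocation_code ++ compile (size relocation_code) ubm_cmd), 1000, 2 => I prom.
have L3 : 3 <= size (ubm_encode I) by rewrite size_encode; lia.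
have [k [lek h]] := decides_compiled wf_ubm_cmd L3 (fun s => ubm_cmd_spec prom).
exists k; split=> //; apply: leq_trans lek _.
have W3 : size (ubm_encode I) <= ubm_size I by rewrite /ubm_size; lia.
have X1 : 0 < maxn 1 (ubm_t I) ^ (2 * ubm_m I) by rewrite expn_gt0; lia.
have : 200 + 112 * size (ubm_encode I) <= 400 * ubm_size I ^ 2 * maxn 1 (ubm_t I) ^ (2 * ubm_m I).
  by apply: leq_trans (leq_pmulr _ X1); rewrite -mulnn; nia.
lia.
Qed.
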